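(* Let $\Gamma$ be a metric graph, $D$ a divisor on $\Gamma$, and $M\subset\mathrm{Rat}(D)$ an admissible semimodule. Then $M$ determines its underlying slope structure uniquely: if $\mathfrak S$ and $\mathfrak S'$ are slope structures on $\Gamma$, of widths $r$ and $r'$ respectively, such that $M$ is admissible of rank $r$ with underlying slope structure $\mathfrak S$ and admissible of rank $r'$ with underlying slope structure $\mathfrak S'$, then $\mathfrak S=\mathfrak S'$.
   Context: Metric graphs. A metric graph $\Gamma$ is the metric realization of a pair $(G,\ell)$, where $G=(V,E)$ is a finite connected graph with at least one edge and $\ell\colon E\to\mathbb R_{>0}$: each edge $e$ is replaced by a closed interval of length $\ell(e)$, glued according to $G$, with the path metric. $G$ (with $\ell$) is called a model of $\Gamma$; a model is simple if it has no loops and no parallel edges. $\mathrm T_x(\Gamma)$ is the finite set of outgoing unit tangent vectors at $x$, and $d_x=|\mathrm T_x(\Gamma)|$. $\mathrm{Rat}(\Gamma)$ is the set of continuous piecewise affine functions $f\colon\Gamma\to\mathbb R$ with integral slopes; $\mathrm{slope}_\nu(f)$ is the outgoing slope of $f$ along $\nu$. A divisor $D$ is a finite formal integer combination of points of $\Gamma$, $D(x)$ is its coefficient at $x$, $D\ge 0$ (effective) means all coefficients are $\geq 0$. $\mathrm{div}(f)=\sum_x \mathrm{ord}_x(f)(x)$ with $\mathrm{ord}_x(f)=-\sum_{\nu\in \mathrm T_x(\Gamma)}\mathrm{slope}_\nu(f)$. $\mathrm{Rat}(D)=\{f\in\mathrm{Rat}(\Gamma): D+\mathrm{div}(f)\ge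 0\}$. Hypercube rank functions. Put $[r]=\{0,\dots,r\}$ for an integer $r\ge 0$. The hypercube $[r]^\delta$ ($\delta\geq 1$) carries the coordinatewise order $\preceq$ and coordinatewise max $\vee$ and min $\wedge$; $\underline e_i$ is the $i$-th unit vector. A rank function is a map $\rho\colon[r]^\delta\to\mathbb Z$ such that: (1) $\rho(t\,\underline e_i)=r-t$ for all $i$ and $t\in[r]$; (2) $\underline a\preceq\underline b$ implies $\rho(\underline b)\le\rho(\underline a)$; (3) $\rho(\underline a)+\rho(\underline b)\le\rho(\underline a\vee\underline b)+\rho(\underline a\wedge\underline b)$; (4) $\rho$ takes values in $\{-1,0,\dots,r\}$. A jump of $\rho$ is a point $\underline a$ with $\rho(\underline a)\ge 0$ and $\rho(\underline a+\underline e_i)=\rho(\underline a)-1$ for every $i$ with $\underline a+\underline e_i\in[r]^\delta$. The standard rank function is $\rho(\underline a)=\max\{-1,r-a_1-\dots-a_\delta\}$. Slope structures. A slope structure $\mathfrak S$ of width $r$ on $\Gamma$ is the data, on some simple graph model $G=(V,E)$ of $\Gamma$, of: for every oriented edge $uv$, a set $S^{uv}$ of integers $s_0^{uv}<\dots<s_r^{uv}$ with $s_i^{uv}+s_{r-i}^{vu}=0$; for every $v\in V$, a rank function $\rho_v$ on $[r]^{d_v}$, whose coordinates are indexed by the oriented edges with tail $v$ (equivalently by $\mathrm T_v(\Gamma)$). It is extended to all of $\Gamma$: for $\nu\in \mathrm T_x(\Gamma)$, $S^\nu=\{s_0^\nu<\dots<s_r^\nu\}$ is $S^{uv}$ for the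 oriented edge $uv$ parallel to $\nu$; for $x\in\Gamma\setminus V$, $\rho_x$ is the standard rank function on $[r]^2$. Two slope structures on $\Gamma$ (possibly given on different models) are equal if they have the same width, the same sets $S^\nu$ and the same rank functions $\rho_x$ for all $x\in\Gamma$, $\nu\in\mathrm T_x(\Gamma)$. For $\underline a=(a_\nu)_\nu\in[r]^{\mathrm T_x(\Gamma)}$ put $s_{\underline a}=(s^\nu_{a_\nu})_\nu$, and let $S^x=\{s_{\underline a}:\underline a\text{ a jump of }\rho_x\}$. A function $f\in\mathrm{Rat}(\Gamma)$ is compatible with $\mathfrak S$ if for every $x\in\Gamma$, $\mathrm{slope}_\nu(f)\in S^\nu$ for all $\nu\in\mathrm T_x(\Gamma)$, and $\partial_x(f):=(\mathrm{slope}_\nu(f))_{\nu\in \mathrm T_x(\Gamma)}\in S^x$. If $\partial_x(f)=s_{\underline a}$, write $\rho_x(\partial_x(f)):=\rho_x(\underline a)$. $\mathrm{Rat}(D,\mathfrak S)$ is the set of $f\in\mathrm{Rat}(D)$ compatible with $\mathfrak S$. Admissible semimodules. A semimodule is a subset of $\mathrm{Rat}(\Gamma)$ stable under $(f,g)\mapsto\min(f,g)$ and $f\mapsto f+c$, $c\in\mathbb R$. A semimodule $M\subseteq\mathrm{Rat}(D)$ is admissible of rank $r$, with underlying slope structure $\mathfrak S$, if it is closed for the topology of $\|\cdot\|_\infty$, $\mathfrak S$ is a slope structure of width $r$ with $M\subseteq\mathrm{Rat}(D,\mathfrak S)$, and for every effective divisor $E$ of degree $r$ there is $f\in M$ with $\rho_x(\partial_x(f))\ge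 E(x)$ for all $x\in\Gamma$ and $D+\mathrm{div}(f)-E\ge 0$. It is admissible if it is admissible of rank $r$ with some underlying slope structure, for some $r\geq 0$. *)

(* Defs.v *)
From HB Require Import structures.
From mathcomp Require Import all_boot all_order all_algebra finmap.
From mathcomp Require Import all_classical all_reals all_analysis.

Set Implicit Arguments.
Unset Strict Implicit.
Unset Printing Implicit Defensive.

Import Order.TTheory GRing.Theory Num.Theory.
Import numFieldNormedType.Exports.

Local Open Scope classical_set_scope.
Local Open Scope ring_scope.

(** * Metric graphs *)

(* Loops and parallel edges are allowed.  The orientation src -> tgt of an edge
   is auxiliary: it only serves to parametrise the edge. *)
Record metric_graph (R : realType) := MetricGraph {
  vertex : finType;
  edge : finType;
  src : edge -> vertex;
  tgt : edge -> vertex;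
  len : edge -> R;
  len_gt0 : forall e, 0 < len e;
  has_edge : (0 < #|edge|)%N;
  graph_connected : forall u v : vertex,
    connect [rel a b | [exists e, ((src e == a) && (tgt e == b))
                               || ((src e == b) && (tgt e == a))]] u v
}.

Section MetricGraphs.
Context {R : realType}.
Implicit Type X : metric_graph R.

Definition simple_graph X : Prop :=
  (forall e : edge X, src e != tgt e) /\
  (forall e e' : edge X,
     [set src e; tgt e]%SET = [set src e'; tgt e']%SET -> e = e').

(* The glued space: its points are the vertices and the pairs (e, t) with
   0 < t < len e, the point of e at distance t from src e. *)
Definition gpoint X : choiceType :=
  (vertex X + {p : edge X * R | 0 < p.2 < len p.1})%type.

(* The parametrisation [0, len e] -> X of the closed edge e, extended by
   constants outside [0, len e]. *)
Definition edge_pt X (e : edge X) (t : R) : gpoint X :=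
  if insub (e, t) is Some p then inr p
  else inl (if t <= 0 then src e else tgt e).

(* The path metric: an infimum of lengths of chains in which two consecutive
   points lie on a common closed edge. *)
Inductive chain X : gpoint X -> gpoint X -> R -> Prop :=
| chain_nil x : chain x x 0
| chain_cons (e : edge X) s t y l :
    0 <= s <= len e -> 0 <= t <= len e ->
    chain (edge_pt e t) y l -> chain (edge_pt e s) y (`|s - t| + l).

Definition dist X (x y : gpoint X) : R := inf [set l | chain x y l].

(* A model of X: a metric graph whose metric realization is identified with
   that of X. *)
Record model X := Model {
  model_graph : metric_graph R;
  model_map : gpoint model_graph -> gpoint X;
  model_map_isometry :
    forall x y, dist (model_map x) (model_map y) = dist x y;
  model_map_surj : forall y, exists x, model_map x = y
}.

(* Oriented edges: (e, true) runs from src e to tgt e, (e, false) backwards. *)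
Definition dart X : finType := (edge X * bool)%type.

Definition tail X (d : dart X) : vertex X := if d.2 then src d.1 else tgt d.1.

Definition flip X (d : dart X) : dart X := (d.1, ~~ d.2).

Definition dart_pt X (d : dart X) (t : R) : gpoint X :=
  edge_pt d.1 (if d.2 then t else len d.1 - t).

(** * Tangent vectors and rational functions *)

(* At a vertex the tangent directions are the oriented edges leaving it (so a
   loop contributes two); at an interior point of an edge they are the two
   orientations of that edge. *)
Definition tangent X (x : gpoint X) : finType :=
  match x with
  | inl v => {d : dart X | tail d == v}
  | inr _ => bool
  end.

Definition tangent_dart X (x : gpoint X) : tangent x -> dart X :=
  match x with
  | inl v => fun nu => val nu
  | inr p => fun b => ((val p).1, b)
  end.

(* The distance from x to the tail of the oriented edge carrying nu. *)
Definition tangent_pos X (x : gpoint X) : tangent x -> R :=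
  match x with
  | inl v => fun=> 0
  | inr p => fun b => if b then (val p).2 else len (val p).1 - (val p).2
  end.

(* For small s >= 0: the point at distance s from x in the direction nu. *)
Definition along X (x : gpoint X) (nu : tangent x) (s : R) : gpoint X :=
  dart_pt (tangent_dart nu) (tangent_pos nu + s).

Definition slope X (f : gpoint X -> R) (x : gpoint X) (nu : tangent x) : int :=
  xget 0 [set m : int | \forall s \near 0^'+,
                          f (along nu s) = f x + m%:~R * s].

(* Continuity is automatic: f is a function on the glued space which is affine
   on each of the finitely many closed pieces of each closed edge. *)
Definition RatG X : set (gpoint X -> R) :=
  [set f | forall e : edge X,
     exists2 ts : seq R, itv_partition 0 (len e) ts &
       forall i, (i < size ts)%N ->
         exists m : int, forall s : R,
           nth 0 (0 :: ts) i <= s <= nth 0 ts i ->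
           f (edge_pt e s) =
             f (edge_pt e (nth 0 (0 :: ts) i))
               + m%:~R * (s - nth 0 (0 :: ts) i)].

Definition ord X (f : gpoint X -> R) (x : gpoint X) : int :=
  - \sum_(nu : tangent x) slope f nu.

End MetricGraphs.

Notation divisor X := {fsfun gpoint X -> int with 0}.

Section Divisors.
Context {R : realType}.
Implicit Type X : metric_graph R.

Definition effective X (D : divisor X) : Prop := forall x, 0 <= D x.

Definition degree X (D : divisor X) : int := \sum_(x <- finsupp D) D x.

Definition RatD X (D : divisor X) : set (gpoint X -> R) :=
  [set f | RatG f /\ forall x, 0 <= D x + ord f x].

End Divisors.

(** * Hypercube rank functions *)

Section RankFunctions.
(* The hypercube [r]^I consists of the a : {ffun I -> 'I_r.+1}. *)
Variables (I : finType) (r : nat).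
Implicit Types (rho : {ffun I -> 'I_r.+1} -> int) (a b : {ffun I -> 'I_r.+1}).

Definition rank_function rho : Prop :=
  [/\ forall (i : I) (t : 'I_r.+1),
        rho [ffun j => if j == i then t else ord0] = r%:Z - t%:Z,
      forall a b, (forall i, (a i <= b i)%N) -> rho b <= rho a,
      forall a b, rho a + rho b <= rho [ffun i => Order.max (a i) (b i)]
                                   + rho [ffun i => Order.min (a i) (b i)]
    & forall a, -1 <= rho a <= r%:Z].

(* The second clause ranges over the i such that b = a + e_i exists in [r]^I. *)
Definition jump rho a : Prop :=
  0 <= rho a /\
  forall (i : I) b, (forall j, b j = (a j + (j == i))%N :> nat) ->
    rho b = rho a - 1.

Definition standard_rank a : int :=
  Order.max (-1) (r%:Z - \sum_(i : I) (a i)%:Z).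

End RankFunctions.

(** * Slope structures *)

Section SlopeStructures.
Context {R : realType}.
Implicit Type X : metric_graph R.

(* The vertices of a model, seen as points of X. *)
Definition model_vertex X (m : model X) (v : vertex (model_graph m)) : gpoint X :=
  model_map (inl v).
Arguments model_vertex {X} m v.

(* The oriented edge d of the model is parallel to nu: it passes through x with
   direction nu. *)
Definition parallel X (m : model X) (x : gpoint X) (nu : tangent x)
    (d : dart (model_graph m)) : Prop :=
  exists2 t : R, 0 <= t < len d.1 &
    \forall s \near 0^'+, along nu s = model_map (dart_pt d (t + s)).

(* edge_slopes d enumerates increasingly the set S^d.  The rank functions are
   recorded at every point x of X, on [r]^(T_x), with the value prescribed off
   the vertices of the model. *)
Record slope_structure X (r : nat) := SlopeStructure {
  base : model X;
  base_simple : simple_graph (model_graph base);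
  edge_slopes : dart (model_graph base) -> 'I_r.+1 -> int;
  edge_slopes_incr : forall d (i j : 'I_r.+1),
    (i < j)%N -> edge_slopes d i < edge_slopes d j;
  edge_slopes_flip : forall d i,
    edge_slopes d i + edge_slopes (flip d) (rev_ord i) = 0;
  rank : forall x : gpoint X, {ffun tangent x -> 'I_r.+1} -> int;
  rank_vertex : forall v, rank_function (@rank (model_vertex base v));
  rank_standard : forall x, (forall v, model_vertex base v <> x) ->
    @rank x = @standard_rank (tangent x) r
}.
Arguments edge_slopes {X r} s d i.
Arguments rank {X r} s {x} a.

Section Theory.
Variables (X : metric_graph R) (r : nat) (S : slope_structure X r).

(* s_i^nu, the value of s_i on the oriented edge parallel to nu. *)
Definition slope_at (x : gpoint X) (nu : tangent x) (i : 'I_r.+1) : int :=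
  xget 0 [set s | exists2 d, parallel nu d & s = edge_slopes S d i].

Definition slope_set (x : gpoint X) (nu : tangent x) : set int :=
  range (slope_at nu).

(* The vector s_a of [r]^(T_x) -> Z^(T_x). *)
Definition slope_vector (x : gpoint X) (a : {ffun tangent x -> 'I_r.+1}) :
    {ffun tangent x -> int} :=
  [ffun nu => slope_at nu (a nu)].

Definition jump_slopes (x : gpoint X) : set {ffun tangent x -> int} :=
  [set slope_vector a | a in jump (rank S (x := x))].

Definition slopes_of (f : gpoint X -> R) (x : gpoint X) :
    {ffun tangent x -> int} :=
  [ffun nu => slope f nu].

Definition compatible (f : gpoint X -> R) : Prop :=
  RatG f /\
  forall x : gpoint X,
    (forall nu : tangent x, slope_set nu (slope f nu)) /\
    jump_slopes (slopes_of f x).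

(* rho_x at the a with slopes_of f x = s_a; this a is unique because the
   enumerations s^nu are strictly increasing. *)
Definition rank_of (f : gpoint X -> R) (x : gpoint X) : int :=
  rank S (xget [ffun=> ord0] [set a | slopes_of f x = slope_vector a]).

Definition RatDS (D : divisor X) : set (gpoint X -> R) :=
  RatD D `&` compatible.

End Theory.

(* Equality of slope structures, possibly given on different models: same
   width, same sets S^nu, same rank functions at all points of X. *)
Definition eq_slope_structure X (r r' : nat)
    (S : slope_structure X r) (S' : slope_structure X r') : Prop :=
  [/\ r = r',
      forall (x : gpoint X) (nu : tangent x), slope_set S nu = slope_set S' nu
    & forall (x : gpoint X) (a : {ffun tangent x -> 'I_r.+1})
             (a' : {ffun tangent x -> 'I_r'.+1}),
        (forall nu, a nu = a' nu :> nat) -> rank S a = rank S' a'].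

(** * Admissible semimodules *)

Definition semimodule X (M : set (gpoint X -> R)) : Prop :=
  [/\ M `<=` @RatG R X,
      forall f g, M f -> M g -> M (fun x => Order.min (f x) (g x))
    & forall f c, M f -> M (fun x => f x + c)].

(* Closedness is relative to RatG X, with the topology of uniform convergence. *)
Definition sup_closed X (M : set (gpoint X -> R)) : Prop :=
  @RatG R X `&` closure (M : set {uniform gpoint X -> R}) `<=` M.

Definition admissible X (D : divisor X) (M : set (gpoint X -> R)) (r : nat)
    (S : slope_structure X r) : Prop :=
  [/\ semimodule M, M `<=` RatD D, sup_closed M, M `<=` RatDS S D
    & forall E : divisor X, effective E -> degree E = r%:Z ->
        exists f, [/\ M f, forall x, E x <= rank_of S f x
                     & forall x, 0 <= D x + ord f x - E x]].

End SlopeStructures.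

(* Main.v *)
Require Import Defs.
From mathcomp Require Import all_boot all_order all_algebra finmap.
From mathcomp Require Import all_classical all_reals all_analysis.
From mathcomp Require Import zify lra ring.

Set Implicit Arguments.
Unset Strict Implicit.
Unset Printing Implicit Defensive.

Import Order.TTheory GRing.Theory Num.Theory.
Import numFieldNormedType.Exports.

Local Open Scope classical_set_scope.
Local Open Scope ring_scope.

(** The slope structure can be read off M: the set S^nu consists of the slopes
    along nu of the elements of M (slope_set_realised), and the jumps of rho_x
    are the vectors of slopes at x of the elements of M (admissible_jump gives
    the inclusion that compatibility does not).  So two underlying slope
    structures have the same slope sets, hence the same width, and their rank
    functions have the same jumps.  A rank function is determined by its jumps,
    because rho(a) + 1 is the largest number of jumps in a strictly increasing
    chain above a (rank_le_of_jumps).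

    In the interior of an edge of the model the rank function is the standard
    one.  Hence a compatible function is concave there, and its rank at y counts
    the indices by which its slope drops at y (interior_drop): a chip at y forces
    the slope to drop.  With r - i chips at x and i chips at a nearby point y in
    the direction nu, the slope leaving x is at most s_i and the slope arriving
    at y is at least s_i; by concavity the slope is s_i all the way.

    For a jump a of rho_x, walk from the origin to a by unit steps.  Each step
    lowers rho_x by 1 or leaves it unchanged.  For a step in the direction i
    that lowers it, put a chip on the ray i, so close to x that the slopes
    already obtained are known to hold up to the chip; it forces one more index
    between x and the chip.  A step that leaves rho_x unchanged costs no chip:
    every jump above its origin is above its end (jump_above_level).  To go on,
    this gain must hold on an interval that does not depend on the function, and
    here the closedness of M enters (uniform_growth).  Otherwise the gain of
    some functions stops arbitrarily close to x, and the infimum of the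
    competing functions of M, all normalised at x, has no gain at all although
    it lies in M.  After rho_x(0) - rho_x(a) chips (forced_growth), the remaining
    rho_x(a) chips are put at x itself; the slopes at x then form a jump above a
    of rank at least rho_x(a), and this can only be a.

    The infimum lies in M for two reasons (inf_values_closed).  It is a uniform
    limit of finite minima, by equicontinuity.  It is a rational function,
    because on a short ray the competing functions are concave with slopes in a
    fixed finite set, and the infimum of such functions is a minimum of finitely
    many affine functions.

    All this takes place along rays of X, whereas S is given on a model of X.
    The isometry between the two maps germs of rays to germs of rays (chart),
    which is proved with explicit functions of Lipschitz constant 1, because
    those bound the path metric from below (dist_ge). *)

(** * Piecewise affine functions of a real variable *)

Section RealVariable.
Context {R : realType}.
Implicit Types (psi : R -> R) (a b c t m : R).

(** Connectedness of [a, b], as an induction principle. *)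
Lemma real_induction (P : R -> Prop) a b :
  a <= b -> P a ->
  (forall t, a <= t < b -> P t ->
     exists2 d, 0 < d & forall s, 0 <= s <= d -> P (t + s)) ->
  (forall t, a < t <= b -> (forall u, a <= u < t -> P u) -> P t) ->
  P b.
Proof.
move=> leab Pa Pright Pleft.
pose T := [set t | a <= t <= b /\ forall u, a <= u <= t -> P u].
have Ta : T a.
  split=> [|u]; first by rewrite lexx.
  by move=> /le_anti <-.
have supT : has_sup T by split; [exists a | exists b => t [/andP[]]].
have le_a : a <= sup T by apply: ub_le_sup => //; case: supT.
have le_b : sup T <= b by apply: ge_sup; [exists a | move=> t [/andP[]]].
have Pbelow u : a <= u < sup T -> P u.
  move=> /andP[au ult].
  have [t [_ Pt] ut] := sup_adherent (eps := sup T - u) (ltac:(by rewrite subr_gt0)) supT.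
  by apply: Pt; rewrite au /=; lra.
have Psup : P (sup T).
  have [eqa|neqa] := eqVneq (sup T) a; first by rewrite eqa.
  by apply: Pleft => //; rewrite lt_neqAle eq_sym neqa le_a.
have [->//|neqb] := eqVneq b (sup T).
have ltb : sup T < b by rewrite lt_neqAle eq_sym neqb.
have [d d0 Pd] := Pright (sup T) (ltac:(by rewrite le_a ltb)) Psup.
pose t := sup T + Num.min d (b - sup T).
have tpos : 0 < Num.min d (b - sup T) by rewrite lt_min d0 subr_gt0.
have Tt : T t.
  have lt1 : Num.min d (b - sup T) <= d by rewrite ge_min lexx.
  have lt2 : Num.min d (b - sup T) <= b - sup T by rewrite ge_min lexx orbT.
  split=> [|u /andP[au ut]]; first by rewrite /t; lra.
  have [ults|ge] := ltP u (sup T); first by apply: Pbelow; rewrite au.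
  rewrite (_ : u = sup T + (u - sup T)); last by ring.
  by apply: Pd; move: ut; rewrite /t; lra.
have : t <= sup T by apply: ub_le_sup => //; case: supT.
by rewrite /t; lra.
Qed.

Lemma near_right0P (P : R -> Prop) :
  (\forall s \near 0^'+, P s) <->
  exists2 d, 0 < d & forall s, 0 < s <= d -> P s.
Proof.
split=> [[d /= d0 dP]|[d d0 dP]].
  exists (d / 2) => [|s /andP[s0 sd]]; first by rewrite divr_gt0.
  apply: dP => //=; rewrite sub0r normrN gtr0_norm//.
  by apply: le_lt_trans sd _; rewrite ltr_pdivrMr// ltr_pMr// ltr1n.
exists d => //= s; rewrite /= sub0r normrN => sd s0.
by apply: dP; rewrite s0 /= ltW//; move: sd; rewrite gtr0_norm.
Qed.

Definition right_slope psi t m : Prop :=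
  exists2 d, 0 < d & forall s, 0 <= s <= d -> psi (t + s) = psi t + m * s.

Definition left_slope psi t m : Prop :=
  exists2 d, 0 < d & forall s, 0 <= s <= d -> psi (t - s) = psi t - m * s.

Lemma right_slope_uniq psi t m m' :
  right_slope psi t m -> right_slope psi t m' -> m = m'.
Proof.
move=> [d d0 Hd] [d' d0' Hd'].
have m0 : 0 < Num.min d d' by rewrite lt_min d0.
have := Hd (Num.min d d') (ltac:(by rewrite ltW //= ge_min lexx)).
rewrite Hd'; last by rewrite ltW //= ge_min lexx orbT.
by move=> /addrI /mulIf ->//; rewrite gt_eqF.
Qed.

Lemma left_slope_uniq psi t m m' :
  left_slope psi t m -> left_slope psi t m' -> m = m'.
Proof.
move=> [d d0 Hd] [d' d0' Hd'].
have m0 : 0 < Num.min d d' by rewrite lt_min d0.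
have := Hd (Num.min d d') (ltac:(by rewrite ltW //= ge_min lexx)).
rewrite Hd'; last by rewrite ltW //= ge_min lexx orbT.
by move=> /addrI /oppr_inj /mulIf ->//; rewrite gt_eqF.
Qed.

Lemma right_slope_minr psi t m d' : 0 < d' -> right_slope psi t m ->
  exists2 d, 0 < d <= d' & forall s, 0 <= s <= d -> psi (t + s) = psi t + m * s.
Proof.
move=> d0' [d d0 Hd]; exists (Num.min d d').
  by rewrite lt_min d0 d0' ge_min lexx orbT.
by move=> s /andP[s0]; rewrite le_min => /andP[sd _]; apply: Hd; rewrite s0.
Qed.

Lemma left_slope_minr psi t m d' : 0 < d' -> left_slope psi t m ->
  exists2 d, 0 < d <= d' & forall s, 0 <= s <= d -> psi (t - s) = psi t - m * s.
Proof.
move=> d0' [d d0 Hd]; exists (Num.min d d').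
  by rewrite lt_min d0 d0' ge_min lexx orbT.
by move=> s /andP[s0]; rewrite le_min => /andP[sd _]; apply: Hd; rewrite s0.
Qed.

(** A bound on the right slopes integrates; the left slopes are only there to
    make psi left continuous. *)
Lemma growth_ge psi a b c : a <= b ->
  (forall t, a <= t < b -> exists2 m, right_slope psi t m & c <= m) ->
  (forall t, a < t <= b -> exists m, left_slope psi t m) ->
  c * (b - a) <= psi b - psi a.
Proof.
move=> leab Hr Hl.
apply: (real_induction (P := fun t => c * (t - a) <= psi t - psi a) leab).
- by rewrite !subrr mulr0.
- move=> t tab Pt; have [m [d d0 Hd] cm] := Hr t tab.
  exists d => // s /[dup] sd /Hd ->.
  have : c * s <= m * s by apply: ler_wpM2r => //; case/andP: sd.
  by move: Pt; lra.
- move=> t tab Pu; have [m [d d0 Hd]] := Hl t tab.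
  rewrite leNgt; apply/negP => Hlt.
  pose gap := c * (t - a) - (psi t - psi a).
  have gap0 : 0 < gap by rewrite /gap subr_gt0.
  pose k := `|m - c| + 1.
  have k0 : 0 < k by rewrite /k ltr_wpDl.
  pose s := Num.min (Num.min d (t - a)) (gap / (2 * k)).
  have s0 : 0 < s.
    by rewrite !lt_min d0 divr_gt0 ?mulr_gt0// andbT /= subr_gt0; case/andP: tab.
  have sd : s <= d by rewrite !ge_min lexx.
  have sa : s <= t - a by rewrite !ge_min lexx !orbT.
  have sg : s * k <= gap / 2.
    have : s <= gap / (2 * k) by rewrite ge_min lexx orbT.
    by rewrite ler_pdivlMr ?mulr_gt0//; lra.
  have := Pu (t - s) (ltac:(lra)).
  rewrite Hd; last by rewrite (ltW s0).
  have : `|m - c| * s <= s * k by rewrite mulrC ler_pM2l// lerDl.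
  have : (c - m) * s <= `|m - c| * s.
    by rewrite ler_pM2r// -normrN opprB ler_norm.
  by move: gap0 sg; rewrite /gap; lra.
Qed.

Lemma right_slopeN psi t m :
  right_slope psi t m -> right_slope (fun s => - psi s) t (- m).
Proof. by move=> [d d0 Hd]; exists d => // s /Hd ->; lra. Qed.

Lemma left_slopeN psi t m :
  left_slope psi t m -> left_slope (fun s => - psi s) t (- m).
Proof. by move=> [d d0 Hd]; exists d => // s /Hd ->; lra. Qed.

Lemma growth_le psi a b c : a <= b ->
  (forall t, a <= t < b -> exists2 m, right_slope psi t m & m <= c) ->
  (forall t, a < t <= b -> exists m, left_slope psi t m) ->
  psi b - psi a <= c * (b - a).
Proof.
move=> leab Hr Hl.
have := @growth_ge (fun s => - psi s) a b (- c) leab.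
have H1 t : a <= t < b ->
    exists2 m, right_slope (fun s => - psi s) t m & - c <= m.
  by move=> /Hr[m /right_slopeN rm mc]; exists (- m) => //; rewrite lerN2.
have H2 t : a < t <= b -> exists m, left_slope (fun s => - psi s) t m.
  by move=> /Hl[m /left_slopeN lm]; exists (- m).
by move=> /(_ H1 H2); lra.
Qed.

(** Concavity in the form in which slope structures give it: the slope can only
    drop at an interior point. *)
Record concave_on psi (p q : R -> R) a b : Prop := ConcaveOn {
  concave_right : forall t, a <= t < b -> right_slope psi t (p t);
  concave_left : forall t, a < t <= b -> left_slope psi t (q t);
  concave_drop : forall t, a < t < b -> p t <= q t
}.

Lemma concave_sub psi p q a b a' b' : a <= a' -> b' <= b ->
  concave_on psi p q a b -> concave_on psi p q a' b'.
Proof.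
move=> aa bb [Hr Hl Hd]; split=> t tab.
- by apply: Hr; lra.
- by apply: Hl; lra.
- by apply: Hd; lra.
Qed.

(** The set of the points up to which the left slope is at most p a is open by
    local affinity to the right, and closed by local affinity to the left. *)
Lemma concave_slopes psi p q a b : concave_on psi p q a b -> a < b ->
  q b <= p a.
Proof.
move=> C ltab.
suff : b = a \/ q b <= p a by case=> // eqb; move: ltab; rewrite eqb ltxx.
apply: (real_induction (P := fun t => t = a \/ q t <= p a) (ltW ltab)).
- by left.
- move=> t tab Pt.
  have pt : p t <= p a.
    have [->//|neta] := eqVneq t a.
    case: Pt => [eqta|qt]; first by rewrite eqta eqxx in neta.
    apply: le_trans qt; apply: (concave_drop C).
    by case/andP: tab => at_ ->; rewrite lt_neqAle eq_sym neta at_.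
  have [d /andP[d0 db] Hd] :=
    right_slope_minr (d' := b - t) (ltac:(lra)) (concave_right C tab).
  exists d => // s /andP[]; rewrite le_eqVlt => /predU1P[<-|s0 sd].
    by rewrite addr0.
  right; apply: le_trans pt.
  suff -> : q (t + s) = p t by [].
  apply: (left_slope_uniq (concave_left C (t := t + s) _)); first by lra.
  exists s => // u us.
  rewrite (_ : t + s - u = t + (s - u)) ?Hd; last 3 first.
  - by lra.
  - by lra.
  - by ring.
  by ring.
- move=> t tab Pu.
  have [d /andP[d0 da] Hd] :=
    left_slope_minr (d' := (t - a) / 2) (ltac:(lra)) (concave_left C tab).
  pose u := t - d / 2.
  have qu : q u = q t.
    apply: (left_slope_uniq (concave_left C (t := u) _)); first by rewrite /u; lra.
    exists (d / 2) => [|s sd]; first by lra.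
    rewrite (_ : u - s = t - (d / 2 + s)) ?Hd; last 3 first.
    - by lra.
    - by lra.
    - by rewrite /u; ring.
    by rewrite /u; ring.
  case: (Pu u (ltac:(by rewrite /u; lra))) => [|]; first by rewrite /u; lra.
  by rewrite qu; right.
Qed.


Lemma concave_ge psi p q a b c t t' : concave_on psi p q a b ->
  a <= t' -> t' <= t -> t <= b -> c <= q b -> c * (t - t') <= psi t - psi t'.
Proof.
move=> C at' tt tb cq; apply: growth_ge => // u utt.
  exists (p u); first by apply: (concave_right C); lra.
  apply: le_trans cq _; apply: concave_slopes; last by apply: lt_le_trans tb; lra.
  by apply: concave_sub C; lra.
by exists (q u); apply: (concave_left C); lra.
Qed.

Lemma concave_le psi p q a b c t t' : concave_on psi p q a b ->
  a <= t' -> t' <= t -> t <= b -> p a <= c -> psi t - psi t' <= c * (t - t').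
Proof.
move=> C at' tt tb cp; apply: growth_le => // u utt.
  exists (p u); first by apply: (concave_right C); lra.
  have [->//|nau] := eqVneq u a.
  have au : a < u by rewrite lt_neqAle eq_sym nau; lra.
  apply: le_trans cp; apply: le_trans (concave_drop C _) _; first by lra.
  by apply: concave_slopes => //; apply: concave_sub C; lra.
by exists (q u); apply: (concave_left C); lra.
Qed.

(** A one-sided slope at t is the slope of a supporting line at t. *)
Lemma concave_support psi p q a b t : concave_on psi p q a b -> a < b ->
  a <= t <= b -> exists2 m, (t < b /\ m = p t) \/ (t = b /\ m = q t) &
    forall u, a <= u <= b -> psi u <= psi t + m * (u - t).
Proof.
move=> C ab tab; have [tb|bt] := ltP t b; last first.
  have -> : t = b by lra.
  exists (q b) => [|u uab]; first by right.
  by have := concave_ge C (t := b) (t' := u) (c := q b); lra.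
exists (p t) => [|u uab]; first by left.
have [ut|tu] := leP u t.
  have [->|nua] := eqVneq u t; first by lra.
  have ltut : u < t by rewrite lt_neqAle nua.
  have C' : concave_on psi p q a t by apply: concave_sub C; lra.
  have pq : p t <= q t by apply: (concave_drop C); lra.
  by have := concave_ge C' (t := t) (t' := u) (c := p t); lra.
have C' : concave_on psi p q t b by apply: concave_sub C; lra.
by have := concave_le C' (t := u) (t' := t) (c := p t); lra.
Qed.

(** The constant terms decide first; slopes only break ties between them. *)
Lemma min_affine_germ (L : seq int) (C : int -> R) : L != [::] ->
  exists2 m, m \in L & exists2 d, 0 < d &
    forall i s, i \in L -> 0 <= s <= d -> C m + m%:~R * s <= C i + i%:~R * s.
Proof.
elim: L => // i L IH _; have [->|/IH[m mL [d d0 Hd]]] := eqVneq L [::].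
  exists i; first by rewrite mem_seq1.
  by exists 1 => // j s; rewrite mem_seq1 => /eqP ->.
suff [[d' d0' Hd']|[d' d0' Hd']] :
    (exists2 d', 0 < d' & forall s, 0 <= s <= d' ->
       C m + m%:~R * s <= C i + i%:~R * s) \/
    (exists2 d', 0 < d' & forall s, 0 <= s <= d' ->
       C i + i%:~R * s <= C m + m%:~R * s).
- exists m; first by rewrite inE mL orbT.
  exists (Num.min d d') => [|j s]; first by rewrite lt_min d0.
  rewrite inE => /predU1P[->|jL] /andP[s0]; rewrite le_min => /andP[sd sd'].
    by apply: Hd'; rewrite s0.
  by apply: Hd => //; rewrite s0.
- exists i; first by rewrite inE eqxx.
  exists (Num.min d d') => [|j s]; first by rewrite lt_min d0.
  rewrite inE => /predU1P[->//|jL] /andP[s0]; rewrite le_min => /andP[sd sd'].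
  apply: le_trans (Hd' _ _) _; first by rewrite s0.
  by apply: Hd => //; rewrite s0.
have strict (j k : int) : C j < C k -> exists2 d', 0 < d' &
    forall s, 0 <= s <= d' -> C j + j%:~R * s <= C k + k%:~R * s.
  move=> Cjk; pose K : R := `|j%:~R - k%:~R| + 1.
  have K0 : 0 < K by rewrite ltr_wpDl.
  exists ((C k - C j) / K) => [|s /andP[s0]].
    by rewrite divr_gt0 // subr_gt0.
  rewrite ler_pdivlMr// => sK.
  have : (j%:~R - k%:~R) * s <= K * s.
    by apply: ler_wpM2r => //; rewrite /K; apply: le_trans (ler_norm _) _; rewrite lerDl.
  by lra.
have [Clt|Clt|Ceq] := ltgtP (C m) (C i).
- by left; apply: strict.
- by right; apply: strict.
have [mi|im] := leP m i.
  left; exists 1 => // s /andP[s0 _]; rewrite Ceq lerD2l ler_wpM2r//.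
  by rewrite ler_int.
right; exists 1 => // s /andP[s0 _]; rewrite Ceq lerD2l ler_wpM2r//.
by rewrite ler_int ltW.
Qed.

(** A concave function with slopes in the finite set L is the minimum over i
    in L of the smallest affine functions of slope i above it.  Taking an
    infimum of such functions only takes the infimum of each constant term, so
    the infimum is again such a minimum. *)
Lemma inf_concave_right_slope (A : set (R -> R)) (L : seq int) b :
  0 < b -> A !=set0 ->
  (forall t, 0 <= t <= b -> has_lbound [set psi t | psi in A]) ->
  (forall psi, A psi -> forall t, 0 <= t <= b ->
     exists2 i : int, i \in L &
       forall u, 0 <= u <= b -> psi u <= psi t + i%:~R * (u - t)) ->
  exists m : int, right_slope (fun t => inf [set psi t | psi in A]) 0 m%:~R.
Proof.
move=> b0 [psi0 Apsi0] lb supp; set g := fun t => _.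
have g_le t psi : 0 <= t <= b -> A psi -> g t <= psi t.
  by move=> tb Apsi; apply: ge_inf; [exact: lb | exists psi].
have le_g t c : (forall psi, A psi -> c <= psi t) -> c <= g t.
  by move=> H; apply: lb_le_inf; [exists (psi0 t); exists psi0|move=> _ [psi ? <-]; exact: H].
pose above (i : int) :=
  [set c : R | exists2 psi, A psi & forall u, 0 <= u <= b -> psi u <= c + i%:~R * u].
have zb : 0 <= (0 : R) <= b by rewrite lexx ltW.
have above_lb i : has_lbound (above i).
  exists (g 0) => c [psi Apsi H].
  by apply: le_trans (g_le _ _ zb Apsi) _; have := H 0 zb; rewrite mulr0 addr0.
have above0 i : above i !=set0.
  have [j _ Hj] := supp _ Apsi0 _ zb.
  exists (psi0 0 + `|j%:~R - i%:~R| * b); exists psi0 => // u /[dup] ub /Hj.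
  have : (j%:~R - i%:~R) * u <= `|j%:~R - i%:~R : R| * b.
    apply: le_trans (ler_norm _) _; rewrite normrM ler_wpM2l//.
    by rewrite ger0_norm; case/andP: ub.
  by lra.
pose C i := inf (above i).
have gC i t : 0 <= t <= b -> g t <= C i + i%:~R * t.
  move=> tb; rewrite -lerBlDr; apply: lb_le_inf => // c [psi Apsi H].
  by rewrite lerBlDr; apply: le_trans (g_le _ _ tb Apsi) (H _ tb).
have L0 : L != [::] by have [i] := supp _ Apsi0 _ zb; case: (L).
have [m mL [d d0 Hm]] := min_affine_germ C L0.
have gE t : 0 <= t <= b -> t <= d -> g t = C m + m%:~R * t.
  move=> tb td; apply/le_anti; rewrite gC//=; apply: le_g => psi Apsi.
  have [i iL Hi] := supp _ Apsi _ tb.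
  apply: le_trans (Hm i t iL _) _; first by lra.
  rewrite -lerBrDr; apply: ge_inf => //; exists psi => // u /Hi.
  by lra.
exists m; exists (Num.min d b) => [|s /andP[s0]]; first by rewrite lt_min d0.
rewrite le_min => /andP[sd sb]; rewrite add0r !gE ?mulr0//; lra.
Qed.

Definition affine_pieces psi a (ts : seq R) : Prop :=
  forall i, (i < size ts)%N ->
    exists m : int, forall s : R, nth 0 (a :: ts) i <= s <= nth 0 ts i ->
      psi s = psi (nth 0 (a :: ts) i) + m%:~R * (s - nth 0 (a :: ts) i).

Lemma affine_pieces_slopes psi a b ts :
  itv_partition a b ts -> affine_pieces psi a ts ->
  (forall t, a <= t < b -> exists m : int, right_slope psi t m%:~R) /\
  (forall t, a < t <= b -> exists m : int, left_slope psi t m%:~R).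
Proof.
elim: ts a => [|x ts IH] a; first by move=> /itv_partition_nil -> _; split=> t; lra.
move=> part pcs; have ax : a < x by case: part => /andP[].
have [m Hm] := pcs 0%N isT; rewrite /= in Hm.
have [Hr Hl] := IH _ (itv_partition_cons part) (fun i => pcs i.+1).
split=> t tab.
- have [tx|xt] := ltP t x; last by apply: Hr; lra.
  exists m; exists (x - t) => [|s sx]; first by lra.
  by rewrite (Hm (t + s)) ?(Hm t); [ring|lra|lra].
- have [tx|xt] := leP t x; last by apply: Hl; lra.
  exists m; exists (t - a) => [|s sx]; first by lra.
  by rewrite (Hm (t - s)) ?(Hm t); [ring|lra|lra].
Qed.

Lemma affine_pieces_rcons psi a u v ts (m : int) : u < v ->
  (forall s, u <= s <= v -> psi s = psi u + m%:~R * (s - u)) ->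
  itv_partition a u ts -> affine_pieces psi a ts ->
  itv_partition a v (rcons ts v) /\ affine_pieces psi a (rcons ts v).
Proof.
move=> uv Hm part pcs; split.
  have := itv_partition_cat part (itv_partition1 uv).
  by rewrite cats1.
move=> i; rewrite size_rcons ltnS leq_eqVlt -rcons_cons !nth_rcons /=.
move=> /predU1P[->|lti].
  rewrite ltnS leqnn ltnn eqxx; exists m => s; case: part => _ /eqP.
  by rewrite (last_nth 0) => ->; apply: Hm.
by rewrite ltnS ltnW // lti; apply: pcs.
Qed.

(** By compactness, being affine to the right and to the left of each point
    is enough to have a finite partition into affine pieces. *)
Lemma slopes_affine_pieces psi a b : a <= b ->
  (forall t, a <= t < b -> exists m : int, right_slope psi t m%:~R) ->
  (forall t, a < t <= b -> exists m : int, left_slope psi t m%:~R) ->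
  exists2 ts, itv_partition a b ts & affine_pieces psi a ts.
Proof.
move=> ab Hr Hl.
pose P t := exists2 ts, itv_partition a t ts & affine_pieces psi a ts.
apply: (real_induction (P := P) ab) => [|t tab [ts part pcs]|t tab Pu].
- by exists [::].
- have [m [d d0 Hd]] := Hr t tab; exists d => // s /andP[].
  rewrite le_eqVlt => /predU1P[<- _|s0 sd]; first by rewrite addr0; exists ts.
  have [||part' pcs'] := @affine_pieces_rcons psi a t (t + s) ts m _ _ part pcs.
  + by lra.
  + move=> u utt; rewrite [in LHS](_ : u = t + (u - t)) ?Hd//; [lra|ring].
  by exists (rcons ts (t + s)).
- have [m Hm] := Hl t tab.
  have [d /andP[d0 da] Hd] := left_slope_minr (d' := t - a) (ltac:(lra)) Hm.
  have [ts part pcs] := Pu (t - d) (ltac:(lra)).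
  have [||part' pcs'] := @affine_pieces_rcons psi a (t - d) t ts m _ _ part pcs.
  + by lra.
  + move=> u utt; rewrite [in LHS](_ : u = t - (t - u)); last by ring.
    by rewrite !Hd; [ring|lra|lra].
  by exists (rcons ts t).
Qed.

End RealVariable.

(** * Rays of a metric graph and its rational functions *)

Section Rays.
Context {R : realType}.
Implicit Type X : metric_graph R.

Lemma edge_pt_in X (e : edge X) t (tP : 0 < t < len e) :
  edge_pt e t = inr (exist (fun p : edge X * R => 0 < p.2 < len p.1) (e, t) tP).
Proof.
rewrite /edge_pt; case: insubP => [[p pP] _ /= pE|]; last by rewrite tP.
by congr inr; apply: val_inj.
Qed.

Lemma edge_pt_src X (e : edge X) t : t <= 0 -> edge_pt e t = inl (src e).
Proof. by move=> t0; rewrite /edge_pt insubN ?t0//= ltNge t0. Qed.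

Lemma edge_pt_tgt X (e : edge X) t : len e <= t -> edge_pt e t = inl (tgt e).
Proof.
move=> lt; rewrite /edge_pt insubN /=; last by rewrite [t < _]ltNge lt andbF.
by rewrite leNgt (lt_le_trans (len_gt0 e)).
Qed.

Lemma dart_pt_tail X (d : dart X) : dart_pt d 0 = inl (tail d).
Proof.
case: d => e [] /=; rewrite /dart_pt /tail /=; first exact: edge_pt_src.
by apply: edge_pt_tgt; rewrite subr0.
Qed.

Lemma dart_pt_flip X (d : dart X) t :
  dart_pt (flip d) t = dart_pt d (len d.1 - t).
Proof. by case: d => e [] //=; rewrite /dart_pt /= subKr. Qed.

Lemma dart_pt_in X (d : dart X) t (tP : 0 < t < len d.1) :
  exists2 p : {p : edge X * R | 0 < p.2 < len p.1}, dart_pt d t = inr p &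
    val p = (d.1, if d.2 then t else len d.1 - t).
Proof.
case: d tP => e b /= tP.
have tP' : 0 < (if b then t else len e - t) < len e by case: b => //; lra.
by rewrite /dart_pt /= (edge_pt_in tP'); exists (exist _ (e, _) tP').
Qed.

Lemma dart_pt_inj X (d d' : dart X) t t' : d.2 = d'.2 ->
  0 < t < len d.1 -> dart_pt d t = dart_pt d' t' -> d.1 = d'.1 /\ t = t'.
Proof.
case: d d' => e b [e' b'] /= <- {b'} tP.
have [p -> pE] := @dart_pt_in _ (e, b) t tP.
have [t'0|t'0] := leP t' 0.
  rewrite /dart_pt; case: b {pE} => /=; last by rewrite edge_pt_tgt //; lra.
  by rewrite edge_pt_src.
have [t'l|t'l] := leP (len e') t'.
  rewrite /dart_pt; case: b {pE} => /=; last by rewrite edge_pt_src //; lra.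
  by rewrite edge_pt_tgt.
have [|p' -> p'E] := @dart_pt_in _ (e', b) t'; first by rewrite t'0.
move=> [pp]; move: pE; rewrite pp p'E /= => -[-> ].
by case: (b) => [->//|]; split=> //; lra.
Qed.

Lemma tangent_pos_bounds X (x : gpoint X) (nu : tangent x) :
  0 <= tangent_pos nu < len (tangent_dart nu).1.
Proof.
case: x nu => [v|[[e t] /= tP]] nu /=; first by rewrite lexx len_gt0.
by case: nu => /=; lra.
Qed.

Lemma along0 X (x : gpoint X) (nu : tangent x) : along nu 0 = x.
Proof.
rewrite /along addr0; case: x nu => [v|[[e t] /= tP]] nu /=.
  by rewrite dart_pt_tail; case: nu => d /= /eqP ->.
by case: nu; rewrite /dart_pt /= ?subKr (edge_pt_in tP).
Qed.

(** Rays describe both sides of each point of an edge, with no distinction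
    between the vertices and the interior points. *)
Lemma ray_at X (d : dart X) t : 0 <= t < len d.1 ->
  exists (x : gpoint X) (nu : tangent x), forall s, along nu s = dart_pt d (t + s).
Proof.
move=> /andP[]; rewrite le_eqVlt => /predU1P[<- _|t0 tl].
  by exists (inl (tail d)), (exist (fun d' => tail d' == tail d) d (eqxx _)).
case: d tl => e [] /= tl.
  have tP : 0 < t < len e by rewrite t0.
  by exists (inr (exist (fun p : edge X * R => 0 < p.2 < len p.1) (e, t) tP)), true.
have tP : 0 < len e - t < len e by lra.
exists (inr (exist (fun p : edge X * R => 0 < p.2 < len p.1) (e, len e - t) tP)).
by exists false => s; rewrite /along /= subKr.
Qed.

Lemma ray_fwd X (e : edge X) t : 0 <= t < len e ->
  exists (x : gpoint X) (nu : tangent x), forall s, along nu s = edge_pt e (t + s).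
Proof. by move=> tP; apply: (@ray_at _ (e, true)). Qed.

Lemma ray_bwd X (e : edge X) t : 0 < t <= len e ->
  exists (x : gpoint X) (nu : tangent x), forall s, along nu s = edge_pt e (t - s).
Proof.
move=> tP; have [|x [nu H]] := @ray_at _ (e, false) (len e - t).
  by rewrite /=; lra.
by exists x, nu => s; rewrite H /dart_pt /=; congr edge_pt; ring.
Qed.

(** Rational functions are described by their germs along rays. *)
Lemma RatGP X (f : gpoint X -> R) :
  RatG f <-> forall (x : gpoint X) (nu : tangent x),
    exists m : int, right_slope (fun s => f (along nu s)) 0 m%:~R.
Proof.
split=> [Rf x nu|Hf e].
- have [ts part pcs] := Rf (tangent_dart nu).1.
  have [Hr Hl] := affine_pieces_slopes (psi := fun s => f (edge_pt _ s)) part pcs.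
  have pos := tangent_pos_bounds nu; rewrite /along /dart_pt.
  case: (tangent_dart nu) pos Hr Hl => e [] /= pos Hr Hl.
    have [m [d d0 Hd]] := Hr _ pos; exists m; exists d => // s sd.
    by rewrite add0r Hd // addr0.
  have [|m [d d0 Hd]] := Hl (len e - tangent_pos nu); first by lra.
  exists (- m); exists d => // s sd; rewrite add0r addr0 mulrNz mulNr -Hd//.
  by congr (f (edge_pt _ _)); ring.
- apply: (slopes_affine_pieces (psi := fun s => f (edge_pt e s))).
  + by rewrite ltW // len_gt0.
  + move=> t tP; have [x [nu nuE]] := ray_fwd tP.
    have [m [d d0 Hd]] := Hf x nu; exists m; exists d => // s sd.
    by have := Hd s sd; rewrite !nuE add0r addr0.
  + move=> t tP; have [x [nu nuE]] := ray_bwd tP.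
    have [m [d d0 Hd]] := Hf x nu; exists (- m); exists d => // s sd.
    by have := Hd s sd; rewrite !nuE add0r subr0 mulrNz mulNr opprK.
Qed.

(** The relation that defines the slope only speaks of positive distances. *)
Lemma slope_germ X (f : gpoint X -> R) (x : gpoint X) (nu : tangent x) (m : int) :
  right_slope (fun s => f (along nu s)) 0 m%:~R <->
  \forall s \near 0^'+, f (along nu s) = f x + m%:~R * s.
Proof.
rewrite near_right0P; split=> -[d d0 Hd]; exists d => // s sd.
  by have := Hd s; rewrite add0r along0; apply; lra.
rewrite add0r along0; case/andP: sd; rewrite le_eqVlt => /predU1P[<- _|s0 sd].
  by rewrite along0 mulr0 addr0.
by apply: Hd; rewrite s0.
Qed.

Lemma slope_eq X (f : gpoint X -> R) (x : gpoint X) (nu : tangent x) (m : int) :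
  right_slope (fun s => f (along nu s)) 0 m%:~R -> slope f nu = m.
Proof.
move=> Hm; have /slope_germ Hx := Hm; rewrite /slope.
have /slope_germ H' := @xgetI _ 0 [set m : int | \forall s \near 0^'+,
  f (along nu s) = f x + m%:~R * s] m Hx.
exact: intr_inj (right_slope_uniq H' Hm).
Qed.

Lemma slopeP X (f : gpoint X -> R) (x : gpoint X) (nu : tangent x) :
  RatG f -> right_slope (fun s => f (along nu s)) 0 (slope f nu)%:~R.
Proof. by move=> /RatGP /(_ x nu)[m Hm]; rewrite (slope_eq Hm). Qed.

(** Connectedness: a vertex without edge would be the whole graph. *)
Lemma tangent_inhabited X (x : gpoint X) : exists nu : tangent x, True.
Proof.
case: x => [v|p]; last by exists true.
suff [d dv] : exists d : dart X, tail d = v by exists (exist _ d (introT eqP dv)).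
have /card_gt0P[e _] := has_edge X.
have /connectP[[|w p] /= pth vE] := graph_connected v (src e).
  by exists (e, true).
case/andP: pth => /existsP[e' /orP[]/andP[/eqP s' /eqP t']] _.
  by exists (e', true).
by exists (e', false).
Qed.

Lemma point_on_edge X (x : gpoint X) :
  exists (e : edge X) (t : R), 0 <= t <= len e /\ x = edge_pt e t.
Proof.
have [nu _] := tangent_inhabited x.
have pos := tangent_pos_bounds nu.
have := along0 nu; rewrite /along addr0 /dart_pt => xE.
exists (tangent_dart nu).1, (if (tangent_dart nu).2 then tangent_pos nu
  else len (tangent_dart nu).1 - tangent_pos nu).
split; last exact/esym.
by case: ifP => _; lra.
Qed.

End Rays.

(** * The path metric near a point *)

Section PathMetric.
Context {R : realType}.
Implicit Type X : metric_graph R.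

(** Lipschitz functions for the path metric, described on each edge. *)
Definition edge_lipschitz X (B : R) (h : gpoint X -> R) : Prop :=
  forall (e : edge X) s t, 0 <= s <= len e -> 0 <= t <= len e ->
    `|h (edge_pt e s) - h (edge_pt e t)| <= B * `|s - t|.

Lemma chain_ge0 X (x y : gpoint X) l : chain x y l -> 0 <= l.
Proof. by elim=> // *; rewrite addr_ge0. Qed.

Lemma chain_lipschitz X B (h : gpoint X -> R) x y l :
  edge_lipschitz B h -> chain x y l -> `|h x - h y| <= B * l.
Proof.
move=> lip; elim=> [z|e s t z l' sP tP _ IH].
  by rewrite subrr normr0 mulr0.
rewrite -(subrKA (h (edge_pt e t))) mulrDr.
by apply: le_trans (ler_normD _ _) (lerD (lip _ _ _ sP tP) IH).
Qed.

Lemma chain_trans X (x y z : gpoint X) l l' :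
  chain x y l -> chain y z l' -> chain x z (l + l').
Proof.
elim=> [?|e s t w k sP tP _ IH] c; first by rewrite add0r.
by rewrite -addrA; apply: chain_cons => //; apply: IH.
Qed.

Lemma chain_edge X (e : edge X) s t : 0 <= s <= len e -> 0 <= t <= len e ->
  chain (edge_pt e s) (edge_pt e t) `|s - t|.
Proof.
by move=> sP tP; have := chain_cons sP tP (chain_nil _); rewrite addr0.
Qed.

Lemma chain_exists X (x y : gpoint X) : exists l, chain x y l.
Proof.
have len0 (e : edge X) : 0 <= len e by rewrite ltW // len_gt0.
have vertices u v : exists l, chain (inl u : gpoint X) (inl v) l.
  have /connectP[p pth ->] := graph_connected u v.
  elim: p u pth => [|w p IH] u /=; first by exists 0; apply: chain_nil.
  move=> /andP[/existsP[e ends] /IH[l c]].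
  have c1 : chain (edge_pt e 0) (edge_pt e (len e)) `|0 - len e|.
    by apply: chain_edge; rewrite ?lexx len0.
  have c2 : chain (edge_pt e (len e)) (edge_pt e 0) `|len e - 0|.
    by apply: chain_edge; rewrite ?lexx len0.
  rewrite (edge_pt_src e (lexx 0)) (edge_pt_tgt (lexx (len e))) in c1 c2.
  case/orP: ends => /andP[/eqP su /eqP tw]; rewrite su tw in c1 c2.
    by eexists; apply: chain_trans c1 c.
  by eexists; apply: chain_trans c2 c.
have [e [s [sP ->]]] := point_on_edge x.
have [e' [s' [sP' ->]]] := point_on_edge y.
have z (e0 : edge X) : 0 <= (0 : R) <= len e0 by rewrite lexx len0.
have c1 := chain_edge sP (z e); have c2 := chain_edge (z e') sP'.
rewrite (edge_pt_src e (lexx 0)) in c1; rewrite (edge_pt_src e' (lexx 0)) in c2.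
have [l c] := vertices (src e) (src e').
by eexists; apply: chain_trans c1 (chain_trans c c2).
Qed.

Lemma dist_le X (x y : gpoint X) l : chain x y l -> dist x y <= l.
Proof. by move=> c; apply: ge_inf => //; exists 0 => l' /chain_ge0. Qed.

Lemma dist_edge_le X (e : edge X) s t : 0 <= s <= len e -> 0 <= t <= len e ->
  dist (edge_pt e s) (edge_pt e t) <= `|s - t|.
Proof. by move=> sP tP; apply/dist_le/chain_edge. Qed.

(** The distance is an infimum over chains; lower bounds for it come from
    functions that vary slowly on each edge. *)
Lemma dist_ge X (h : gpoint X -> R) x y :
  edge_lipschitz 1 h -> `|h x - h y| <= dist x y.
Proof.
move=> lip; apply: lb_le_inf; first exact: chain_exists.
by move=> l /(chain_lipschitz lip); rewrite mul1r.
Qed.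

Definition glue X (hv : vertex X -> R) (he : edge X -> R -> R) (x : gpoint X) : R :=
  match x with inl v => hv v | inr p => he (val p).1 (val p).2 end.

Lemma glueE X hv he : (forall e : edge X, he e 0 = hv (src e)) ->
  (forall e : edge X, he e (len e) = hv (tgt e)) ->
  forall (e : edge X) t, 0 <= t <= len e -> glue hv he (edge_pt e t) = he e t.
Proof.
move=> h0 h1 e t /andP[]; rewrite le_eqVlt => /predU1P[<- _|t0].
  by rewrite edge_pt_src /=.
rewrite le_eqVlt => /predU1P[->|tl]; first by rewrite edge_pt_tgt /=.
have tP : 0 < t < len e by rewrite t0.
by rewrite (edge_pt_in tP).
Qed.

Lemma lip_tent (c w s t : R) :
  `|Num.max 0 (w - `|s - c|) - Num.max 0 (w - `|t - c|)| <= `|s - t|.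
Proof.
have h1 : `|s - c| <= `|s - t| + `|t - c|.
  by rewrite -{1}(subrKA t) ler_normD.
have h2 : `|t - c| <= `|s - t| + `|s - c|.
  by rewrite -{1}(subrKA s) distrC ler_normD.
have h0 := normr_ge0 (s - t).
rewrite ler_distl /Num.max.
by case: (ltP 0 (w - `|s - c|)); case: (ltP 0 (w - `|t - c|)); lra.
Qed.

(** The bump of height w and slope 1 around the position c of a dart; it tells
    the points of this edge near c from all other points. *)
Definition tent X (d : dart X) (c w : R) : gpoint X -> R :=
  glue (fun=> 0) (fun e t =>
    if e == d.1 then Num.max 0 (w - `|(if d.2 then t else len e - t) - c|) else 0).

Lemma tentE X (d : dart X) c w (e : edge X) t :
  w <= c -> c + w <= len d.1 -> 0 <= t <= len e ->
  tent d c w (edge_pt e t) =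
    if e == d.1 then Num.max 0 (w - `|(if d.2 then t else len e - t) - c|) else 0.
Proof.
move=> wc cw tP; rewrite /tent glueE // => e'; case: eqP => // ->;
  case: (d.2); apply/max_idPl.
- by rewrite sub0r normrN; have := ler_norm c; lra.
- by rewrite subr0; have := ler_norm (len d.1 - c); lra.
- by have := ler_norm (len d.1 - c); lra.
- by rewrite subrr sub0r normrN; have := ler_norm c; lra.
Qed.

Lemma tent_dart X (d : dart X) c w t :
  w <= c -> c + w <= len d.1 -> 0 <= t <= len d.1 ->
  tent d c w (dart_pt d t) = Num.max 0 (w - `|t - c|).
Proof.
move=> wc cw tP; rewrite /dart_pt tentE //; last by case: ifP => _; lra.
by rewrite eqxx; case: (d.2); rewrite ?subKr.
Qed.

Lemma tent_other X (d d' : dart X) c w t :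
  w <= c -> c + w <= len d.1 -> 0 <= t <= len d'.1 -> d'.1 != d.1 ->
  tent d c w (dart_pt d' t) = 0.
Proof.
move=> wc cw tP neq; rewrite /dart_pt tentE //; last by case: ifP => _; lra.
by rewrite (negPf neq).
Qed.

Lemma tent_lipschitz X (d : dart X) c w : w <= c -> c + w <= len d.1 ->
  edge_lipschitz 1 (tent d c w).
Proof.
move=> wc cw e s t sP tP; rewrite !tentE // mul1r.
case: eqP => [->|_]; last by rewrite subrr normr0 normr_ge0.
case: (d.2); first exact: lip_tent.
apply: le_trans (lip_tent _ _ _ _) _.
have -> : len d.1 - s - (len d.1 - t) = t - s by ring.
by rewrite distrC.
Qed.

Lemma tent_support X (d : dart X) c w z : 0 < tent d c w z ->
  exists2 t, 0 < t < len d.1 & z = dart_pt d t.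
Proof.
case: z => [v|[[e t] /= tP]]; first by rewrite /tent /= ltxx.
rewrite /tent /=; case: eqP => [eE|_]; last by rewrite ltxx.
case: d eE => e' b /= eE; subst e'; case: b => _.
  by exists t => //; rewrite /dart_pt (edge_pt_in tP).
exists (len e - t); first by lra.
by rewrite /dart_pt /= subKr (edge_pt_in tP).
Qed.

Lemma dist_dart_le X (d : dart X) s t : 0 <= s <= len d.1 -> 0 <= t <= len d.1 ->
  dist (dart_pt d s) (dart_pt d t) <= `|s - t|.
Proof.
move=> sP tP; apply: le_trans (dist_edge_le _ _) _.
- by case: ifP => _; lra.
- by case: ifP => _; lra.
- case: (d.2) => //.
  have -> : len d.1 - s - (len d.1 - t) = t - s by ring.
  by rewrite distrC.
Qed.

(** The tent centred in the middle of what remains of the edge measures the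
    distance to the origin of the ray. *)
Lemma along_isometry X (x : gpoint X) (nu : tangent x) s t :
  let d := (len (tangent_dart nu).1 - tangent_pos nu) / 2 in
  0 <= s <= d -> 0 <= t <= d -> dist (along nu s) (along nu t) = `|s - t|.
Proof.
move=> d; have : d = (len (tangent_dart nu).1 - tangent_pos nu) / 2 by [].
rewrite /along; have := tangent_pos_bounds nu; move: d (tangent_dart nu) (tangent_pos nu).
move=> r d p pos rE sP tP; apply/le_anti/andP; split.
  apply: le_trans (dist_dart_le _ _) _; [lra|lra|].
  by have -> : p + s - (p + t) = s - t by ring.
have H1 : r <= p + r by lra.
have H2 : p + r + r <= len d.1 by lra.
have tE u : 0 <= u <= r -> tent d (p + r) r (dart_pt d (p + u)) = u.
  move=> uP; rewrite tent_dart //; last by lra.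
  have -> : p + u - (p + r) = - (r - u) by ring.
  by rewrite normrN ger0_norm ?subKr; [apply/max_idPr; lra|lra].
by rewrite -{1}(tE s) // -{1}(tE t) //; apply/dist_ge/tent_lipschitz.
Qed.

(** The tent of height s around the point at distance s on one ray vanishes on
    the other rays. *)
Lemma rays_apart X (y : gpoint X) : exists2 eps : R, 0 < eps &
  forall (mu mu' : tangent y) s s', mu != mu' -> 0 < s < eps -> 0 < s' < eps ->
    s <= dist (along mu s) (along mu' s').
Proof.
suff [eps e0 H] : exists2 eps : R, 0 < eps & forall (mu mu' : tangent y) s s',
    mu != mu' -> 0 < s < eps -> 0 < s' < eps ->
    let d := tangent_dart mu in let p := tangent_pos mu in
    p + s + s <= len d.1 /\ tent d (p + s) s (along mu' s') = 0.
  exists eps => // mu mu' s s' neq sP sP'; have := H mu mu' s s' neq sP sP'.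
  have pos := tangent_pos_bounds mu.
  set d := tangent_dart mu in pos *; set p := tangent_pos mu in pos *.
  move=> [ps t0]; have H1 : s <= p + s by lra.
  have := dist_ge (along mu s) (along mu' s') (tent_lipschitz H1 ps).
  rewrite t0 subr0 tent_dart; [|lra|lra|rewrite -/p; lra].
  by rewrite subrr normr0 subr0 (max_idPr _) ?gtr0_norm //; lra.
case: y => [v|[[e t] tP]].
- have [L L0 LP] : exists2 L : R, 0 < L & forall e : edge X, L <= len e.
    exists (\big[Num.min/1]_(e : edge X) len e).
      by apply: lt_bigmin => // e _; apply: len_gt0.
    by move=> e; apply: bigmin_le_cond.
  (* A third of the length keeps the two rays of a loop apart. *)
  exists (L / 3) => [|[d dv] [d' dv'] s s' neq sP sP' /=]; first by lra.
  have Ld := LP d.1; have Ld' := LP d'.1; split; first by lra.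
  rewrite /along /=; have [dd|dd] := eqVneq d'.1 d.1; last first.
    by apply: tent_other => //; lra.
  have -> : d' = flip d.
    move: neq; rewrite -val_eqE /=.
    case: d d' dd {dv dv' Ld Ld'} => e b [e' b'] /= <-.
    by case: b; case: b'; rewrite /flip //= eqxx.
  rewrite dart_pt_flip tent_dart; [|lra|lra|lra].
  by apply/max_idPl; have := ler_norm (len d.1 - (0 + s') - (0 + s)); lra.
- move: (tP) => /= tP'; exists (Num.min t (len e - t) / 2) => [|b b' s s' neq].
    by rewrite divr_gt0 // lt_min; lra.
  rewrite /= !ltr_pdivlMr // !lt_min => sP sP'; split.
    by case: ifP; lra.
  have -> : b' = ~~ b by case: b b' neq => [] [].
  have alongE : along (x := inr (exist _ (e, t) tP)) (~~ b) s' =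
      dart_pt (e, b) ((if b then t else len e - t) - s').
    rewrite /along /dart_pt; case: (b) => /=; congr edge_pt; ring.
  apply: (etrans (congr1 (tent _ _ _) alongE)).
  rewrite tent_dart /=; [|by case: ifP; lra ..].
  apply/max_idPl; set p := if b then _ else _.
  by have := ler_norm (- (p - s' - (p + s))); rewrite normrN; lra.
Qed.

(** Around a vertex v, the function max 0 (L - dist v) is given on each edge by
    the distances to those ends of the edge that are equal to v; around an
    interior point of an edge, the tent at this point plays the same part. *)
Lemma ball_rays X (y : gpoint X) : exists2 eps : R, 0 < eps &
  forall z, dist y z < eps -> exists mu : tangent y, z = along mu (dist y z).
Proof.
case: y => [v|p].
- have [L L0 LP] : exists2 L : R, 0 < L & forall e : edge X, L <= len e.
    exists (\big[Num.min/1]_(e : edge X) len e).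
      by apply: lt_bigmin => // e _; apply: len_gt0.
    by move=> e; apply: bigmin_le_cond.
  pose A (b : bool) : R := if b then L else 0.
  pose hv u := A (u == v).
  pose he (e : edge X) t := Num.max 0
    (Num.max (A (src e == v) - t) (A (tgt e == v) - (len e - t))).
  have A0 b : 0 <= A b by rewrite /A; case: b; lra.
  have AL b : A b <= L by rewrite /A; case: b; lra.
  have he0 e : he e 0 = hv (src e).
    have ab : A (tgt e == v) - len e <= A (src e == v).
      by have := LP e; have := AL (tgt e == v); have := A0 (src e == v); lra.
    by rewrite /he /hv !subr0 (max_idPl ab) (max_idPr (A0 _)).
  have he1 e : he e (len e) = hv (tgt e).
    have ab : A (src e == v) - len e <= A (tgt e == v).
      by have := LP e; have := AL (src e == v); have := A0 (tgt e == v); lra.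
    by rewrite /he /hv subrr subr0 (max_idPr ab) (max_idPr (A0 _)).
  have hE := glueE he0 he1.
  have lip : edge_lipschitz 1 (glue hv he).
    move=> e s t sP tP; rewrite !hE // mul1r /he ler_distl.
    have := ler_norm (s - t); have := ler_norm (t - s); rewrite (distrC t s).
    have max_cases (x y : R) : Num.max x y = x /\ y <= x \/ Num.max x y = y /\ x <= y.
      by rewrite /Num.max; case: (ltP x y); [right; split=> //; apply: ltW|left].
    set k := `|s - t|; set a := A (src e == v); set b := A (tgt e == v).
    case: (max_cases (a - s) (b - (len e - s))) => -[-> ?];
    case: (max_cases (a - t) (b - (len e - t))) => -[-> ?];
    rewrite /Num.max; by do 2 case: ifP => /negP ?; lra.
  exists L => // z zL.
  have zpos : L - dist (inl v) z <= glue hv he z.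
    have := dist_ge (inl v) z lip; rewrite [glue hv he (inl v)]/hv /= eqxx.
    by have := ler_norm (L - glue hv he z); rewrite /A; lra.
  have len0 (e : edge X) : 0 <= (0 : R) <= len e by rewrite lexx ltW // len_gt0.
  have found (d : dart X) t : tail d = v -> 0 <= t <= len d.1 ->
      t <= dist (inl v) (dart_pt d t) ->
      exists mu : tangent (inl v : gpoint X),
        dart_pt d t = along mu (dist (inl v) (dart_pt d t)).
    move=> dv tP tle; exists (exist _ d (introT eqP dv)).
    suff -> : dist (inl v) (dart_pt d t) = t by rewrite /along /= add0r.
    apply/le_anti; rewrite tle andbT; have := dist_dart_le (len0 d.1) tP.
    by rewrite dart_pt_tail dv sub0r normrN ger0_norm //; case/andP: tP.
  have [e [t [tP zE]]] := point_on_edge z; subst z; rewrite hE // in zpos.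
  have : 0 < he e t by lra.
  rewrite /he lt_max ltxx /= lt_max => pos.
  have [Ht|Ht] : L - dist (inl v) (edge_pt e t) <= A (src e == v) - t \/
      L - dist (inl v) (edge_pt e t) <= A (tgt e == v) - (len e - t).
    move: zpos; rewrite /he !le_max => /orP[|/orP[]]; [|by left|by right].
    by lra.
  - have sv : src e = v.
      by apply/eqP; move: Ht; rewrite /A; case: (src e == v) => //; lra.
    by apply: (found (e, true)) => //; move: Ht; rewrite sv eqxx /A /dart_pt /=; lra.
  - have tv : tgt e = v.
      by apply/eqP; move: Ht; rewrite /A; case: (tgt e == v) => //; lra.
    have zE : edge_pt e t = dart_pt (e, false) (len e - t).
      by rewrite /dart_pt /= subKr.
    rewrite zE; apply: (found (e, false)) => //=; first by lra.
    by rewrite -zE; move: Ht; rewrite tv eqxx /A; lra.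
- pose e := (val p).1; pose t := (val p).2; pose y : gpoint X := inr p.
  have tP : 0 < t < len e by apply: (valP p).
  have yE : y = dart_pt (e, true) t.
    rewrite /dart_pt /= (edge_pt_in tP); congr inr; apply: val_inj => /=.
    exact: surjective_pairing.
  pose w := Num.min t (len e - t).
  have w0 : 0 < w by rewrite lt_min; lra.
  have wt : w <= t by rewrite ge_min lexx.
  have wl : t + w <= len (e, true).1.
    by have : w <= len e - t by [rewrite ge_min lexx orbT]; rewrite /=; lra.
  exists w => // z; rewrite -/y => zw.
  have := dist_ge y z (tent_lipschitz wt wl).
  rewrite {1}yE tent_dart //=; last by lra.
  rewrite subrr normr0 subr0 (max_idPr _) ?(ltW w0) // => near.
  have [|u /= uP zE] := @tent_support _ (e, true) t w z.
    by have := ler_norm (w - tent (e, true) t w z); lra.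
  have duE : dist y z = `|t - u|.
    apply/le_anti/andP; split; first by rewrite yE zE; apply: dist_dart_le; rewrite /=; lra.
    have := le_trans (ler_norm _) near.
    rewrite {1}zE tent_dart //=; last by lra.
    by rewrite (distrC u t) /Num.max; case: (ltP 0 (w - `|t - u|)); lra.
  have [tu|ut] := leP t u.
    exists true; rewrite duE distrC ger0_norm ?subr_ge0 // zE /along /=.
    by rewrite addrC subrK.
  exists false; rewrite duE ger0_norm ?subr_ge0 ?ltW // zE /along /dart_pt /=.
  by rewrite -/e -/t; congr edge_pt; ring.
Qed.

(** The preimage of a ray of X in the model is a unit speed path.  Each of its
    points near the origin is on a ray from the origin, and it cannot be on two
    different rays at two times, since different rays separate too fast. *)
Lemma chart X (m : model X) (x : gpoint X) (nu : tangent x) :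
  exists (d : dart (model_graph m)) (t delta : R),
    [/\ 0 < delta, 0 <= t, t + delta < len d.1,
        tangent_pos nu + delta < len (tangent_dart nu).1 &
        forall s, 0 <= s <= delta -> along nu s = model_map (dart_pt d (t + s))].
Proof.
have [y yx] := model_map_surj m x.
have [eta etaE] := choice (fun s => model_map_surj m (along nu s)).
have pos := tangent_pos_bounds nu.
pose e1 : R := (len (tangent_dart nu).1 - tangent_pos nu) / 2.
have e1pos : 0 < e1 by rewrite /e1; lra.
have isoe s s' : 0 <= s <= e1 -> 0 <= s' <= e1 ->
    dist (eta s) (eta s') = `|s - s'|.
  by move=> sP sP'; rewrite -(@model_map_isometry _ _ m) !etaE along_isometry.
have isoy s : 0 <= s <= e1 -> dist y (eta s) = s.
  move=> sP; rewrite -(@model_map_isometry _ _ m) etaE yx -{1}(along0 nu).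
  by rewrite along_isometry ?sub0r ?normrN ?ger0_norm //; rewrite -/e1; lra.
have [e2 e2pos Hball] := ball_rays y.
have [e3 e3pos Hapart] := rays_apart y.
pose e4 := Num.min e1 (Num.min e2 e3) / 2.
have e4pos : 0 < e4 by rewrite divr_gt0 // !lt_min e1pos e2pos.
have lt4 : [/\ e4 < e1, e4 < e2 & e4 < e3].
  have := e4pos; rewrite /e4; set k := Num.min _ _ => k0.
  have := lexx k; rewrite {2}/k !le_min => /and3P[? ? ?]; split; lra.
have mu_of s : 0 < s <= e4 -> exists mu : tangent y, eta s = along mu s.
  move=> sP; have es := isoy s (ltac:(case: lt4; lra)).
  have [|mu] := Hball (eta s); first by rewrite es; case: lt4; lra.
  by rewrite es; exists mu.
have [mu muE] := mu_of e4 (ltac:(rewrite e4pos lexx //)).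
have along_mu s : 0 < s <= e4 -> eta s = along mu s.
  move=> sP; have [mu' muE'] := mu_of s sP.
  have [<-//|neq] := eqVneq mu' mu.
  have [ltx1 ltx2 ltx3] := lt4.
  have := Hapart mu' mu s e4 neq (ltac:(lra)) (ltac:(lra)).
  have := Hapart mu mu' e4 s (ltac:(by rewrite eq_sym)) (ltac:(lra)) (ltac:(lra)).
  rewrite -muE -muE' !isoe; [|lra ..].
  have -> : `|e4 - s| = e4 - s by rewrite ger0_norm //; lra.
  have -> : `|s - e4| = e4 - s by rewrite distrC ger0_norm //; lra.
  have /andP[s0 _] := sP => h1 _; have : s <= 0 by lra.
  by rewrite leNgt s0.
have posm := tangent_pos_bounds mu.
pose e5 := Num.min e4 ((len (tangent_dart mu).1 - tangent_pos mu) / 2).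
have e5pos : 0 < e5 by rewrite lt_min e4pos /=; lra.
have [le4 lem] : e5 <= e4 /\ e5 <= (len (tangent_dart mu).1 - tangent_pos mu) / 2.
  by have := lexx e5; rewrite {2}/e5 le_min => /andP.
exists (tangent_dart mu), (tangent_pos mu), e5; split; [by []|lra|lra| |].
  by case: lt4; rewrite /e1; lra.
move=> s /andP[]; rewrite le_eqVlt => /predU1P[<- _|s0 s5].
  by rewrite along0 -[dart_pt _ _]/(along mu 0) along0.
by rewrite -etaE along_mu //; lra.
Qed.

Lemma dist_refl X (x : gpoint X) : dist x x <= 0.
Proof. exact/dist_le/chain_nil. Qed.

(** A tent at an interior point of an edge separates it from all other points,
    so that an isometry is injective there. *)
Lemma model_map_inj X (m : model X) (d : dart (model_graph m)) t z :
  0 < t < len d.1 -> model_map (dart_pt d t) = model_map z -> dart_pt d t = z.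
Proof.
move=> tP E; have d0 : dist (dart_pt d t) z <= 0.
  by rewrite -(@model_map_isometry _ _ m) E dist_refl.
pose w := Num.min t (len d.1 - t).
have w0 : 0 < w by rewrite lt_min; lra.
have [wt wl] : w <= t /\ w <= len d.1 - t.
  by have := lexx w; rewrite {2}/w le_min => /andP.
have wl' : t + w <= len d.1 by lra.
have := dist_ge (dart_pt d t) z (tent_lipschitz wt wl').
rewrite tent_dart //; last by lra.
rewrite subrr normr0 subr0 (max_idPr _) ?(ltW w0) // => near.
have [|u uP zE] := @tent_support _ d t w z.
  by have := ler_norm (w - tent d t w z); lra.
rewrite zE; congr dart_pt; apply/eqP; rewrite -subr_eq0 -normr_le0.
have := le_trans (ler_norm _) near; rewrite {1}zE tent_dart //; last by lra.
by rewrite (distrC u t) /Num.max; case: (ltP 0 (w - `|t - u|)); lra.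
Qed.

(** Two opposite darts of one edge are told apart by two points of the ray. *)
Lemma parallel_uniq X (m : model X) (x : gpoint X) (nu : tangent x)
    (d d' : dart (model_graph m)) :
  parallel nu d -> parallel nu d' -> d = d'.
Proof.
move=> [t tP /near_right0P[e e0 He]] [t' tP' /near_right0P[e' e0' He']].
pose k := Num.min (Num.min e e') (Num.min (len d.1 - t) (len d'.1 - t')) / 2.
have k0 : 0 < k by rewrite divr_gt0 // !lt_min e0 e0'; lra.
have [ke ke' kl kl'] : [/\ k < e, k < e', k < len d.1 - t & k < len d'.1 - t'].
  have := k0; rewrite /k; set k1 := Num.min _ _ => k0'.
  have := lexx k1; rewrite {2}/k1 !le_min => /andP[/andP[? ?] /andP[? ?]].
  by split; lra.
have E s : 0 < s <= k -> dart_pt d (t + s) = dart_pt d' (t' + s).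
  move=> sP; apply: model_map_inj; first by lra.
  by rewrite -He ?He' //; lra.
have [b|b] := eqVneq d.2 d'.2.
  have [||e1 _] := dart_pt_inj b _ (E k _); [lra|lra|].
  by case: d d' b e1 {He He' E kl kl' tP tP' k k0 ke ke'} => ? ? [? ?] /= -> ->.
have b' : d.2 = (flip d').2 by case: (d.2) b => /=; case: (d'.2).
have E' s : 0 < s <= k -> dart_pt d (t + s) = dart_pt (flip d') (len d'.1 - (t' + s)).
  by move=> sP; rewrite E // dart_pt_flip subKr.
have [||_ q1] := dart_pt_inj b' _ (E' k _); [lra|lra|].
have [||_ q2] := dart_pt_inj b' _ (E' (k / 2) _); [lra|lra|].
have : k <= 0 by lra.
by rewrite leNgt k0.
Qed.

End PathMetric.

(** * Slope structures along a ray *)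

Section SlopesAlongRays.
Context {R : realType}.
Variables (X : metric_graph R) (r : nat) (S : slope_structure X r).

Lemma parallel_exists (x : gpoint X) (nu : tangent x) :
  exists d : dart (model_graph (base S)), parallel nu d.
Proof.
have [d [t [e [e0 t0 te _ H]]]] := chart (base S) nu.
exists d, t; first by lra.
by apply/near_right0P; exists e => // s sP; apply: H; lra.
Qed.

Lemma slope_atE (x : gpoint X) (nu : tangent x) (d : dart (model_graph (base S))) i :
  parallel nu d -> slope_at S nu i = edge_slopes d i.
Proof.
move=> nud; rewrite /slope_at.
set A := [set s | _].
have : A (xget 0 A) by apply: xgetPex; exists (edge_slopes d i), d.
by move=> [d' nud' ->]; rewrite (parallel_uniq nud nud').
Qed.

Lemma slope_at_incr (x : gpoint X) (nu : tangent x) (i j : 'I_r.+1) :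
  (slope_at S nu i < slope_at S nu j) = (i < j)%N.
Proof.
have [d nud] := parallel_exists nu; rewrite !(slope_atE _ nud).
have [ij|ji|/ord_inj ->] := ltngtP i j; last by rewrite ltxx.
- exact: edge_slopes_incr.
- by apply/negbTE; rewrite -leNgt ltW // edge_slopes_incr.
Qed.

Lemma slope_at_le (x : gpoint X) (nu : tangent x) (i j : 'I_r.+1) :
  (slope_at S nu i <= slope_at S nu j) = (i <= j)%N.
Proof. by rewrite leNgt slope_at_incr -leqNgt. Qed.

Lemma slope_at_inj (x : gpoint X) (nu : tangent x) : injective (slope_at S nu).
Proof.
move=> i j E; apply/ord_inj/eqP.
by rewrite eqn_leq -!(slope_at_le nu) E lexx.
Qed.

Lemma slope_vector_inj (x : gpoint X) : injective (@slope_vector _ _ _ S x).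
Proof.
move=> a b /ffunP E; apply/ffunP => nu.
by have := E nu; rewrite !ffunE => /slope_at_inj.
Qed.

Lemma rank_of_vector (f : gpoint X -> R) (x : gpoint X) a :
  slopes_of f x = slope_vector S a -> rank_of S f x = rank S a.
Proof.
move=> fa; rewrite /rank_of.
have := @xgetI _ [ffun=> ord0] [set a | slopes_of f x = slope_vector S a] a fa.
by rewrite /= fa => /slope_vector_inj <-.
Qed.

Lemma compatible_jump (f : gpoint X -> R) (x : gpoint X) : compatible S f ->
  exists a, [/\ jump (rank S (x := x)) a, rank_of S f x = rank S a &
    forall nu : tangent x, slope f nu = slope_at S nu (a nu)].
Proof.
move=> [_ /(_ x)[_ [a ja fa]]]; exists a; split=> //; first exact: rank_of_vector.
by move=> nu; have /ffunP/(_ nu) := fa; rewrite !ffunE.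
Qed.

(** At a point in the interior of an edge of the model, the standard rank
    function makes compatible functions concave, the rank being the number of
    indices by which the slope drops. *)
Lemma interior_drop (f : gpoint X -> R) (p : {p : edge X * R | 0 < p.2 < len p.1})
    (b : bool) (d : dart (model_graph (base S))) :
  compatible S f -> (forall v, model_vertex (m := base S) v <> inr p) ->
  parallel (x := inr p) b d -> parallel (x := inr p) (~~ b) (flip d) ->
  exists o i : 'I_r.+1,
    [/\ slope f (x := inr p) b = edge_slopes d o,
        slope f (x := inr p) (~~ b) = - edge_slopes d i,
        (o <= i)%N & rank_of S f (inr p) = i%:Z - o%:Z].
Proof.
move=> cf nv pb pnb.
have [a [ja ra sa]] := compatible_jump (inr p) cf.
have a0 : 0 <= rank S a by case: ja.
rewrite ra; move: a0; rewrite rank_standard // /standard_rank => a0.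
have sum_a : \sum_(i : tangent (inr p : gpoint X)) (a i)%:Z =
    (a b)%:Z + (a (~~ b))%:Z.
  by rewrite big_bool; case: (b); rewrite // addrC.
rewrite sum_a in a0 *.
have ab : (a b + a (~~ b) <= r)%N by move: a0; rewrite le_max /=; lia.
have revE : (rev_ord (a (~~ b)) = r - a (~~ b) :> nat)%N by rewrite /= subSS.
exists (a b), (rev_ord (a (~~ b))); split.
- by rewrite sa (slope_atE _ pb).
- rewrite sa (slope_atE _ pnb); apply/eqP; rewrite -addr_eq0 addrC.
  by have := edge_slopes_flip d (rev_ord (a (~~ b))); rewrite rev_ordK => ->.
- by rewrite revE; lia.
- by rewrite revE; lia.
Qed.

(** Both slopes at distance t are taken in the direction nu, away from x: inc t
    is the index of the slope before t, and out t of the slope after t. *)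
Definition ray_slopes (x : gpoint X) (nu : tangent x) (f : gpoint X -> R)
    (b : R) (out inc : R -> 'I_r.+1) : Prop :=
  [/\ forall t, 0 <= t < b ->
        right_slope (fun s => f (along nu s)) t (slope_at S nu (out t))%:~R,
      forall t, 0 < t < b ->
        left_slope (fun s => f (along nu s)) t (slope_at S nu (inc t))%:~R &
      forall t, 0 < t < b -> (out t <= inc t)%N /\
        rank_of S f (along nu t) = (inc t)%:Z - (out t)%:Z].

Lemma ray_slopes_exist (x : gpoint X) (nu : tangent x) : exists2 b, 0 < b &
  forall f, compatible S f -> exists out inc, ray_slopes nu f b out inc.
Proof.
have [d [t0 [b [b0 t00 tb tb' alongE]]]] := chart (base S) nu.
exists b => // f cf.
have Rf : RatG f by case: cf.
have pos := tangent_pos_bounds nu.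
suff H : forall t, exists oi : 'I_r.+1 * 'I_r.+1,
  [/\ 0 <= t < b ->
        right_slope (fun s => f (along nu s)) t (slope_at S nu oi.1)%:~R,
      0 < t < b ->
        left_slope (fun s => f (along nu s)) t (slope_at S nu oi.2)%:~R &
      0 < t < b -> (oi.1 <= oi.2)%N /\
        rank_of S f (along nu t) = oi.2%:Z - oi.1%:Z].
  have [oi oiP] := choice H.
  by exists (fun t => (oi t).1), (fun t => (oi t).2); split=> t tP; case: (oiP t); auto.
move=> t; have [tP|tn] := boolP (0 < t < b); last first.
  have [a [_ _ sa]] := compatible_jump x cf.
  exists (a nu, ord0); split=> //= tP; have -> : t = 0 by lra.
  by rewrite -sa; apply: slopeP.
have tP1 : 0 < tangent_pos nu + t < len (tangent_dart nu).1 by lra.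
have [p pE pv] := dart_pt_in tP1; rewrite -[dart_pt _ _]/(along nu t) in pE.
pose c := (tangent_dart nu).2.
have fwd s : along (x := inr p) c s = along nu (t + s).
  rewrite /along /dart_pt /= pv /= /c; case: (tangent_dart nu).2 => /=.
    by rewrite addrA.
  by congr edge_pt; ring.
have bwd s : along (x := inr p) (~~ c) s = along nu (t - s).
  rewrite /along /dart_pt /= pv /= /c; case: (tangent_dart nu).2 => /=.
    by congr edge_pt; ring.
  by congr edge_pt; ring.
have pc : parallel (x := inr p) c d.
  exists (t0 + t); first by lra.
  apply/near_right0P; exists (b - t) => [|s sP]; first by lra.
  by rewrite fwd alongE ?addrA //; lra.
have pnc : parallel (x := inr p) (~~ c) (flip d).
  exists (len d.1 - (t0 + t)); first by rewrite /=; lra.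
  apply/near_right0P; exists t => [|s sP]; first by lra.
  rewrite bwd alongE; last by lra.
  by rewrite dart_pt_flip; congr (model_map (dart_pt _ _)); ring.
have nv v : model_vertex (m := base S) v <> inr p.
  have tP2 : 0 < t0 + t < len d.1 by lra.
  rewrite -pE alongE; last by lra.
  move=> /esym /(model_map_inj tP2).
  by have [q ->] := dart_pt_in tP2.
have [out [inc [so si oi ri]]] := interior_drop cf nv pc pnc.
have [d' nud'] := parallel_exists nu.
have nud : parallel nu d.
  exists t0; first by lra.
  by apply/near_right0P; exists b => // s sP; apply: alongE; lra.
exists (out, inc); split=> _ /=; rewrite ?(slope_atE _ nud).
- have [e e0 He] := slopeP (x := inr p) c Rf; rewrite so in He.
  by exists e => // s /He; rewrite !fwd add0r addr0.
- have [e e0 He] := slopeP (x := inr p) (~~ c) Rf; rewrite si in He.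
  exists e => // s /He; rewrite !bwd add0r subr0 => ->.
  by rewrite mulrNz mulNr.
- by split=> //; rewrite pE.
Qed.

End SlopesAlongRays.

(** * Infima of functions compatible with a slope structure *)

Section Infima.
Context {R : realType}.
Variables (X : metric_graph R) (r : nat) (S : slope_structure X r).

Lemma ray_concave (x : gpoint X) (nu : tangent x) f b out inc b' :
  ray_slopes S nu f b out inc -> b' < b ->
  concave_on (fun s => f (along nu s))
    (fun t => (slope_at S nu (out t))%:~R) (fun t => (slope_at S nu (inc t))%:~R)
    0 b'.
Proof.
move=> [Hr Hl Hd] ltb; split=> t tP.
- by apply: Hr; lra.
- by apply: Hl; lra.
- by rewrite ler_int slope_at_le; case: (Hd t) => //; lra.
Qed.

(** Finitely many slopes occur, since the model has finitely many edges. *)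
Lemma compatible_lipschitz : exists2 B : R, 0 <= B &
  forall f, compatible S f -> edge_lipschitz B f.
Proof.
pose B : R := \sum_(d : dart (model_graph (base S))) \sum_(i < r.+1)
  `|(edge_slopes d i)%:~R|.
have B0 : 0 <= B by do 2 apply: sumr_ge0 => ? _.
exists B => // f cf; have Rf : RatG f by case: cf.
have slopeB (x : gpoint X) (nu : tangent x) : - B <= (slope f nu)%:~R <= B.
  have [a [_ _ ->]] := compatible_jump x cf.
  have [d nud] := parallel_exists S nu.
  rewrite (slope_atE _ nud) -ler_norml /B (bigD1 d) //= (bigD1 (a nu)) //=.
  by rewrite -addrA lerDl addr_ge0 // sumr_ge0 // => ? _; apply: sumr_ge0.
suff lip (e : edge X) s t : 0 <= s <= len e -> 0 <= t <= len e -> s <= t ->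
    `|f (edge_pt e s) - f (edge_pt e t)| <= B * `|s - t|.
  move=> e s t sP tP; have [st|ts] := leP s t; first exact: lip.
  by rewrite distrC (distrC s); apply: lip => //; apply: ltW.
move=> sP tP st; rewrite distrC (distrC s) (ger0_norm (x := t - s)) ?subr_ge0 //.
have Hr c : (forall (x : gpoint X) (nu : tangent x), c (slope f nu)) ->
    forall u, s <= u < t ->
    exists2 m : R, right_slope (fun v => f (edge_pt e v)) u m & exists2 k, c k & m = k%:~R.
  move=> Hc u uP; have [|x [nu nuE]] := @ray_fwd _ _ e u; first by lra.
  exists (slope f nu)%:~R; last by exists (slope f nu).
  have [d d0 Hd] := slopeP nu Rf; exists d => // v /Hd.
  by rewrite !nuE add0r addr0.
have Hl u : s < u <= t -> exists m, left_slope (fun v => f (edge_pt e v)) u m.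
  move=> uP; have [|x [nu nuE]] := @ray_bwd _ _ e u; first by lra.
  exists (- (slope f nu)%:~R).
  have [d d0 Hd] := slopeP nu Rf; exists d => // v /Hd.
  by rewrite !nuE add0r subr0 mulNr opprK.
rewrite ler_norml -mulNr; apply/andP; split.
  apply: (growth_ge (psi := fun v => f (edge_pt e v)) st _ Hl) => u uP.
  have [m Hm [k kB mE]] := Hr (fun k => - B <= k%:~R)
    (fun x nu => proj1 (andP (slopeB x nu))) u uP.
  by exists m; rewrite // mE.
apply: (growth_le (psi := fun v => f (edge_pt e v)) st _ Hl) => u uP.
have [m Hm [k kB mE]] := Hr (fun k => k%:~R <= B)
  (fun x nu => proj2 (andP (slopeB x nu))) u uP.
by exists m; rewrite // mE.
Qed.

Section MinClosed.
Variables (A : set (gpoint X -> R)) (x0 : gpoint X).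
Hypothesis A0 : A !=set0.
Hypothesis A_compatible : A `<=` compatible S.
Hypothesis A_min : forall f g, A f -> A g -> A (fun x => Order.min (f x) (g x)).
Hypothesis A_normal : forall f, A f -> f x0 = 0.

Let g (x : gpoint X) : R := inf [set f x | f in A].

Lemma has_lbound_values (x : gpoint X) : has_lbound [set f x | f in A].
Proof.
have [B B0 lip] := compatible_lipschitz.
have [l c] := chain_exists x0 x.
exists (- (B * l)) => _ [f Af <-].
have := chain_lipschitz (lip _ (A_compatible Af)) c.
by rewrite A_normal // sub0r normrN ler_norml => /andP[].
Qed.

Lemma inf_values_le f (x : gpoint X) : A f -> g x <= f x.
Proof. by move=> Af; apply: ge_inf; [exact: has_lbound_values|exists f]. Qed.

Lemma le_inf_values c (x : gpoint X) : (forall f, A f -> c <= f x) -> c <= g x.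
Proof.
move=> H; apply: lb_le_inf; first by have [f Af] := A0; exists (f x), f.
by move=> _ [f Af <-]; apply: H.
Qed.

Lemma inf_values_approx (x : gpoint X) (eta : R) : 0 < eta ->
  exists2 f, A f & f x <= g x + eta.
Proof.
move=> eta0; have [|_ [f Af <-] lt] := inf_adherent (E := [set f x | f in A]) eta0.
  by split; [have [f Af] := A0; exists (f x), f|exact: has_lbound_values].
by exists f => //; apply: ltW.
Qed.

Lemma inf_values_lipschitz B : (forall f, A f -> edge_lipschitz B f) ->
  edge_lipschitz B g.
Proof.
move=> lip e s t sP tP.
have one s' t' : 0 <= s' <= len e -> 0 <= t' <= len e ->
    g (edge_pt e s') - B * `|s' - t'| <= g (edge_pt e t').
  move=> sP' tP'; apply: le_inf_values => f Af.
  have := lip f Af e s' t' sP' tP'; have := inf_values_le (edge_pt e s') Af.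
  by rewrite ler_norml => ? /andP[]; lra.
have := one s t sP tP; have := one t s tP sP.
by rewrite (distrC t s) ler_norml; lra.
Qed.

(** Near each point of an edge one function of A is close to the infimum, by
    equicontinuity; minima glue these functions together. *)
Lemma inf_values_uniform (eta : R) : 0 < eta ->
  exists2 f, A f & forall x, f x <= g x + eta.
Proof.
move=> eta0; have [B0 B00 lip0] := compatible_lipschitz.
pose B := B0 + 1; have Bpos : 0 < B by rewrite /B; lra.
have lip f : A f -> edge_lipschitz B f.
  move=> /A_compatible/lip0 lf e s t sP tP; apply: le_trans (lf e s t sP tP) _.
  by rewrite /B ler_wpM2r // lerDl.
have lipg := inf_values_lipschitz lip.
pose rho := eta / 4 / B.
have rho0 : 0 < rho by rewrite !divr_gt0.
have Brho : B * rho = eta / 4 by rewrite /rho mulrC divfK // gt_eqF.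
have local (e : edge X) t : 0 <= t <= len e -> exists2 f, A f &
    forall u, 0 <= u <= len e -> `|u - t| <= rho ->
      f (edge_pt e u) <= g (edge_pt e u) + eta.
  move=> tP; have [|f Af ft] := @inf_values_approx (edge_pt e t) (eta / 2).
    by lra.
  exists f => // u uP ut.
  have := lip f Af e u t uP tP; have := lipg e u t uP tP.
  have : B * `|u - t| <= eta / 4 by rewrite -Brho ler_pM2l.
  by rewrite !ler_norml; lra.
have one (e : edge X) : exists2 f, A f & forall u, 0 <= u <= len e ->
    f (edge_pt e u) <= g (edge_pt e u) + eta.
  have len0 := ltW (len_gt0 e).
  pose P t := exists2 f, A f & forall u, 0 <= u <= t ->
    f (edge_pt e u) <= g (edge_pt e u) + eta.
  have glue_min t v f f' : A f -> A f' ->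
      (forall u, 0 <= u <= t -> f (edge_pt e u) <= g (edge_pt e u) + eta) ->
      (forall u, t <= u <= v -> f' (edge_pt e u) <= g (edge_pt e u) + eta) -> P v.
    move=> Af Af' Hf Hf'; exists (fun x => Order.min (f x) (f' x)); first exact: A_min.
    move=> u uv; rewrite ge_min; have [ut|tu] := leP u t.
      by rewrite Hf //; lra.
    by rewrite Hf' ?orbT //; lra.
  apply: (real_induction (P := P) len0) => [|t tP [f Af Hf]|t tP Pu].
  - have [|f Af Hf] := local e 0; first by rewrite lexx.
    exists f => // u uP; apply: Hf; first by lra.
    by have -> : u = 0 by [lra]; rewrite subrr normr0 ltW.
  - have [|f' Af' Hf'] := local e t; first by lra.
    exists (Num.min rho (len e - t)) => [|s].
      by rewrite lt_min rho0 /=; lra.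
    rewrite le_min => /andP[s0 /andP[srho slen]].
    apply: (glue_min t _ f f') => // u uP; apply: Hf'; first by lra.
    by rewrite ger0_norm; lra.
  - have [|f' Af' Hf'] := local e t; first by lra.
    pose k := Num.min rho t.
    have [kr kt] : k <= rho /\ k <= t by have := lexx k; rewrite {2}/k le_min => /andP.
    have k0 : 0 < k by rewrite lt_min rho0 /=; lra.
    have [|f Af Hf] := Pu (t - k); first by lra.
    apply: (glue_min (t - k) _ f f') => // u uP; apply: Hf'; first by lra.
    by rewrite distrC ger0_norm; lra.
have [f Af Hf] : exists2 f, A f & forall (e : edge X), e \in enum (edge X) ->
    forall u, 0 <= u <= len e -> f (edge_pt e u) <= g (edge_pt e u) + eta.
  elim: (enum _) => [|e s [f Af Hf]]; first by have [f Af] := A0; exists f.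
  have [f' Af' Hf'] := one e.
  exists (fun x => Order.min (f x) (f' x)); first exact: A_min.
  move=> e'; rewrite inE => /predU1P[->|e's] u uP; rewrite ge_min.
    by rewrite Hf' ?orbT.
  by rewrite Hf.
exists f => // x; have [e [u [uP ->]]] := point_on_edge x.
by apply: Hf; rewrite ?mem_enum.
Qed.

(** On a short ray the slopes of all functions of A lie in the same finite set,
    to which inf_concave_right_slope applies. *)
Lemma inf_values_RatG : RatG g.
Proof.
apply/RatGP => x nu; have [b b0 Hb] := ray_slopes_exist S nu.
pose A' := [set (fun s => f (along nu s)) | f in A].
pose L := [seq slope_at S nu i | i : 'I_r.+1].
have b20 : 0 < b / 2 by lra.
have lb t : 0 <= t <= b / 2 -> has_lbound [set psi t | psi in A'].
  move=> _; have [c Hc] := has_lbound_values (along nu t).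
  by exists c => _ [_ [f Af <-] <-]; apply: Hc; exists f.
have A'0 : A' !=set0 by have [f Af] := A0; exists (fun s => f (along nu s)), f.
have supp psi : A' psi -> forall t, 0 <= t <= b / 2 -> exists2 i : int, i \in L &
    forall u, 0 <= u <= b / 2 -> psi u <= psi t + i%:~R * (u - t).
  move=> [f Af <-] t tP; have [out [inc H]] := Hb f (A_compatible Af).
  have C := ray_concave H (ltac:(lra) : b / 2 < b).
  have [m mE Hm] := concave_support C b20 tP.
  have [k kE] : exists k, m = (slope_at S nu k)%:~R.
    by case: mE => -[_ ->]; [exists (out t)|exists (inc t)].
  exists (slope_at S nu k); first by apply: map_f; rewrite mem_enum.
  by rewrite -kE.
have [m [d d0 Hd]] := inf_concave_right_slope b20 A'0 lb supp.
have gE s : inf [set psi s | psi in A'] = g (along nu s).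
  congr inf; apply/seteqP; split=> [_ [_ [f Af <-] <-]|_ [f Af <-]]; first by exists f.
  by exists (fun s => f (along nu s)) => //; exists f.
by exists m, d => // s /Hd; rewrite !gE.
Qed.

Lemma inf_values_closed (M : set (gpoint X -> R)) :
  sup_closed M -> A `<=` M -> M g.
Proof.
move=> clM AM; apply: clM; split; first exact: inf_values_RatG.
move=> U /uniform_nbhs [E [entE EU]]; move: entE; rewrite -entourage_ballE.
move=> [eta /= eta0 etaE].
have [|f Af Hf] := @inf_values_uniform (eta / 2); first by lra.
exists f; split; first exact: AM.
apply: EU => y _; apply: etaE => /=; rewrite /ball /=.
have := inf_values_le y Af; have := Hf y.
by rewrite ltr_norml; lra.
Qed.

End MinClosed.
End Infima.

(** * Rank functions are determined by their jumps *)

Section RankFunctionTheory.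
Variables (I : finType) (r : nat).
Implicit Types (rho : {ffun I -> 'I_r.+1} -> int) (a b : {ffun I -> 'I_r.+1}).

Lemma val_ord_max (x y : 'I_r.+1) : Order.max x y = maxn x y :> nat.
Proof. by rewrite /Order.max ltEord; case: ltnP => H; lia. Qed.

Lemma val_ord_min (x y : 'I_r.+1) : Order.min x y = minn x y :> nat.
Proof. by rewrite /Order.min ltEord; case: ltnP => H; lia. Qed.

Definition up a i : {ffun I -> 'I_r.+1} :=
  [ffun j => if j == i then inord (a j).+1 else a j].

Lemma upE a i j : (a i < r)%N -> up a i j = (a j + (j == i))%N :> nat.
Proof.
by move=> ai; rewrite ffunE; case: eqP => [->|_]; rewrite ?inordK //; lia.
Qed.

Lemma up_uniq a i b :
  (forall j, b j = (a j + (j == i))%N :> nat) -> (a i < r)%N /\ b = up a i.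
Proof.
move=> bE; have ai : (a i < r)%N.
  by have := bE i; have := ltn_ord (b i); rewrite eqxx; lia.
by split=> //; apply/ffunP => j; apply: ord_inj; rewrite upE.
Qed.

(** Supermodularity is the convexity of the map sending n to max (-1) (r - n). *)
Lemma standard_rank_function : rank_function (@standard_rank I r).
Proof.
split.
- move=> i t; rewrite /standard_rank (bigD1 i) //= ffunE eqxx.
  rewrite big1 => [|j ji]; last by rewrite ffunE (negPf ji).
  by have := ltn_ord t; lia.
- move=> a b ab; rewrite /standard_rank.
  have : \sum_(i : I) (a i)%:Z <= \sum_(i : I) (b i)%:Z.
    by apply: ler_sum => i _; rewrite lez_nat.
  by lia.
- move=> a b; rewrite /standard_rank.
  set A := \sum_(i : I) (a i)%:Z; set B := \sum_(i : I) (b i)%:Z.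
  set U := \sum_(i : I) _%:Z; set L := \sum_(i : I) _%:Z.
  have UL : U + L = A + B.
    rewrite /U /L /A /B -!big_split; apply: eq_bigr => i _ /=.
    by rewrite !ffunE val_ord_max val_ord_min; lia.
  have LA : L <= A by apply: ler_sum => i _; rewrite ffunE val_ord_min; lia.
  have LB : L <= B by apply: ler_sum => i _; rewrite ffunE val_ord_min; lia.
  by lia.
- move=> a; rewrite /standard_rank.
  have : 0 <= \sum_(i : I) (a i)%:Z by apply: sumr_ge0.
  by lia.
Qed.

Variable rho : {ffun I -> 'I_r.+1} -> int.
Hypothesis rho_rank : rank_function rho.

Lemma rank_mono a b : (forall i, (a i <= b i)%N) -> rho b <= rho a.
Proof. by case: rho_rank => _ H _ _; apply: H. Qed.

Lemma rank_axis a i : rho a <= r%:Z - (a i)%:Z.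
Proof.
case: rho_rank => H1 H2 _ _; rewrite -(H1 i).
by apply: H2 => j; rewrite ffunE; case: eqP => [->|_].
Qed.

Lemma rank_origin a (i : I) : (forall j, a j = 0 :> nat) -> rho a = r%:Z.
Proof.
case: rho_rank => H1 _ _ _ a0.
have -> : a = [ffun j => if j == i then ord0 else ord0].
  by apply/ffunP => j; rewrite ffunE if_same; apply: ord_inj; rewrite a0.
by rewrite H1 subr0.
Qed.

(** Supermodularity compares a step from a with the same step on the axis,
    where the rank drops by exactly 1. *)
Lemma rank_up_ge a i : (a i < r)%N -> rho a - 1 <= rho (up a i).
Proof.
move=> ai; case: rho_rank => H1 _ H3 _.
pose c k : {ffun I -> 'I_r.+1} := [ffun j => if j == i then k else ord0].
have := H3 a (c (inord (a i).+1)).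
have -> : [ffun j => Order.max (a j) (c (inord (a i).+1) j)] = up a i.
  apply/ffunP => j; rewrite !ffunE; apply: ord_inj; rewrite val_ord_max.
  by case: eqP => [->|_] /=; rewrite ?inordK //; lia.
have -> : [ffun j => Order.min (a j) (c (inord (a i).+1) j)] = c (a i).
  apply/ffunP => j; rewrite !ffunE; apply: ord_inj; rewrite val_ord_min.
  by case: eqP => [->|_] /=; rewrite ?inordK //; lia.
by rewrite /c !H1 inordK //; lia.
Qed.

Lemma rank_up_le a i : (a i < r)%N -> rho (up a i) <= rho a.
Proof. by move=> ai; apply: rank_mono => j; rewrite upE // leq_addr. Qed.

Lemma jump_up a i : jump rho a -> (a i < r)%N -> rho (up a i) = rho a - 1.
Proof. by move=> [_ H] ai; apply: (H i) => j; rewrite upE. Qed.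

Lemma jump_maximal a b : jump rho a -> (forall i, (a i <= b i)%N) ->
  rho a <= rho b -> b = a.
Proof.
move=> ja ab le; apply/ffunP => i; apply: ord_inj; apply/eqP.
rewrite eqn_leq ab andbT leqNgt; apply/negP => lti.
have ai : (a i < r)%N by have := ltn_ord (b i); lia.
have : rho b <= rho (up a i).
  apply: rank_mono => j; rewrite upE //; have := ab j.
  by case: eqP => [->|_]; lia.
by rewrite (jump_up ja ai); lia.
Qed.

(** If b i were equal to a i, then by supermodularity the step i from b would
    not lower the rank either. *)
Lemma jump_above_level a b i : jump rho b -> (forall j, (a j <= b j)%N) ->
  (a i < r)%N -> rho (up a i) = rho a -> (a i < b i)%N.
Proof.
move=> jb ab ai eqrho; rewrite ltn_neqAle ab andbT; apply/eqP => abi.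
have bi : (b i < r)%N by rewrite -abi.
case: rho_rank => _ _ H3 _; have := H3 b (up a i).
have -> : [ffun j => Order.max (b j) (up a i j)] = up b i.
  apply/ffunP => j; apply: ord_inj; rewrite ffunE val_ord_max !upE //.
  have [->|_] := j =P i; first by rewrite abi; apply/maxn_idPr/leq_addr.
  by rewrite !addn0; apply/maxn_idPl/ab.
have -> : [ffun j => Order.min (b j) (up a i j)] = a.
  apply/ffunP => j; apply: ord_inj; rewrite ffunE val_ord_min !upE //.
  have [->|_] := j =P i; first by rewrite -abi; apply/minn_idPl/leq_addr.
  by rewrite addn0; apply/minn_idPr/ab.
by rewrite (jump_up jb bi) eqrho; lia.
Qed.

(** Climb from a along the steps that leave the rank unchanged. *)
Lemma exists_jump_above a : 0 <= rho a ->
  exists b, [/\ jump rho b, rho b = rho a & forall i, (a i <= b i)%N].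
Proof.
have [n] := ubnP (\sum_(i : I) (r - a i)); elim: n a => // n IH a; rewrite ltnS => an a0.
have [[i ai eqi]|nex] := pselect (exists2 i, (a i < r)%N & rho (up a i) = rho a).
  have upi j := upE j ai.
  have [|b [jb rb ub]] := IH (up a i) _ (ltac:(by rewrite eqi)).
    apply: leq_trans an; rewrite (bigD1 i) // [X in (_ < X)%N](bigD1 i) //=.
    rewrite upi eqxx -addSn leq_add //; first by lia.
    by apply: leq_sum => j _; rewrite upi; lia.
  exists b; split=> //; first by rewrite rb eqi.
  by move=> j; apply: leq_trans (ub j); rewrite upi leq_addr.
exists a; split=> //; split=> // i b /up_uniq[ai ->].
have := rank_up_ge ai; have := rank_up_le ai.
suff : rho (up a i) <> rho a by lia.
by move=> e; apply: nex; exists i.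
Qed.

End RankFunctionTheory.

(** Above a point of rank k there is a chain of jumps of ranks k, ..., 0; along
    it, the other rank function drops at every step as well. *)
Lemma rank_le_of_jumps (I : finType) (r : nat) (i : I)
    (rho rho' : {ffun I -> 'I_r.+1} -> int) :
  rank_function rho -> rank_function rho' -> (forall a, jump rho a -> jump rho' a) ->
  forall a, rho a <= rho' a.
Proof.
move=> R R' sub a; have [neg|pos] := ltP (rho a) 0.
  by case: R' => _ _ _ /(_ a); lia.
have [k] : exists k : nat, rho a = k%:Z by exists `|rho a|%N; lia.
elim: k a {pos} => [|k IH] a ak.
all: have [|b [jb rb ab]] := exists_jump_above R (a := a); rewrite ?ak //.
all: have := rank_mono R' ab.
  by case: (sub _ jb) => b0 _; lia.
have bi : (b i < r)%N by have := rank_axis R b i; lia.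
have := jump_up (sub _ jb) bi; have := IH (up b i); rewrite (jump_up jb bi) rb ak.
by move=> /(_ (ltac:(lia))); lia.
Qed.

(** * Admissible semimodules realise all jumps *)

Section Admissible.
Context {R : realType}.
Variables (X : metric_graph R) (D : divisor X) (M : set (gpoint X -> R)).
Variables (r : nat) (S : slope_structure X r).
Hypothesis admM : admissible D M S.

Lemma admissible_compatible f : M f -> compatible S f.
Proof. by case: admM => _ _ _ sub _ /sub[]. Qed.

Lemma rank_at_rank_function (x : gpoint X) : rank_function (rank S (x := x)).
Proof.
have [[v <-]|nv] := pselect (exists v, model_vertex (m := base S) v = x).
  exact: rank_vertex.
rewrite rank_standard; first exact: standard_rank_function.
by move=> v vx; apply: nv; exists v.
Qed.

(** Chips are recorded as a list of points, so that adding chips to a divisor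
    is a concatenation. *)
Lemma effective_of_points (s : seq (gpoint X)) : exists E : divisor X,
  [/\ effective E, degree E = (size s)%:Z & forall x, E x = (count_mem x s)%:Z].
Proof.
pose E : divisor X := [fsfun z in [fset y in s]%fset => (count_mem z s)%:Z].
have EE x : E x = (count_mem x s)%:Z.
  rewrite fsfunE inE /=; case: ifP => // /negbT xs.
  by rewrite (count_memPn xs).
exists E; split=> // [x|]; first by rewrite EE.
rewrite /degree (eq_bigr _ (fun x _ => EE x)).
rewrite (perm_big (undup s)); last first.
  apply: uniq_perm; rewrite ?undup_uniq ?fset_uniq // => x.
  by rewrite mem_undup mem_finsupp EE -has_pred1 has_count; lia.
have /perm_size := perm_count_undup s; rewrite size_flatten /shape -map_comp => <-.
rewrite sumnE big_map (big_morph Posz PoszD (erefl _)).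
by apply: eq_bigr => x _; rewrite /= size_nseq.
Qed.

Lemma admissible_points (s : seq (gpoint X)) : size s = r ->
  exists2 f, M f & forall x, (count_mem x s)%:Z <= rank_of S f x.
Proof.
move=> sr; have [E [Eeff Edeg Ex]] := effective_of_points s.
case: admM => _ _ _ _ /(_ E Eeff); rewrite Edeg sr => /(_ (erefl _))[f [Mf Hf _]].
by exists f => // x; rewrite -Ex.
Qed.

(** A lower bound c for the slopes on the first part of a ray, in a form that
    passes to minima and to infima. *)
Definition growth (f : gpoint X -> R) (x : gpoint X) (nu : tangent x) (c e : R) : Prop :=
  forall t t', 0 <= t' -> t' <= t -> t <= e ->
    c * (t - t') <= f (along nu t) - f (along nu t').

Lemma growth_sub f (x : gpoint X) (nu : tangent x) c e e' :
  e' <= e -> growth f nu c e -> growth f nu c e'.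
Proof. by move=> ee H t t' t0 tt te; apply: H => //; lra. Qed.

Lemma ray_growth f (x : gpoint X) (nu : tangent x) b out inc e (i : 'I_r.+1) :
  ray_slopes S nu f b out inc -> e < b -> (i <= inc e)%N ->
  growth f nu (slope_at S nu i)%:~R e.
Proof.
move=> H eb ie t t' t0 tt te.
by apply: (concave_ge (ray_concave H eb)) => //; rewrite ler_int slope_at_le.
Qed.

Lemma growth_slope f (x : gpoint X) (nu : tangent x) c e :
  RatG f -> 0 < e -> growth f nu c e -> c <= (slope f nu)%:~R.
Proof.
move=> Rf e0 G.
have [d /andP[d0 de] Hd] := right_slope_minr e0 (slopeP nu Rf).
have := G d 0 (lexx 0) (ltW d0) de; rewrite -{2}(add0r d) Hd; last by lra.
by rewrite subr0 addrC addKr ler_pM2r.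
Qed.

Lemma growth_out f (x : gpoint X) (nu : tangent x) b out inc e (i : 'I_r.+1) t :
  ray_slopes S nu f b out inc -> e <= b -> 0 <= t < e ->
  growth f nu (slope_at S nu i)%:~R e -> (i <= out t)%N.
Proof.
move=> [Hr _ _] eb te G; rewrite -(slope_at_le S nu) -(ler_int R).
have [d /andP[d0 de] Hd] := right_slope_minr (d' := e - t) (ltac:(lra)) (Hr t (ltac:(lra))).
have := G (t + d) t (ltac:(lra)) (ltac:(lra)) (ltac:(lra)).
rewrite Hd; last by lra.
by rewrite addrC addKr addrC addKr ler_pM2r.
Qed.

Lemma uniform_ray_slopes (x : gpoint X) : exists2 b, 0 < b &
  forall (nu : tangent x) f, M f -> exists out inc, ray_slopes S nu f b out inc.
Proof.
have H (nu : tangent x) : exists b, 0 < b /\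
    forall f, compatible S f -> exists out inc, ray_slopes S nu f b out inc.
  by have [b b0 Hb] := ray_slopes_exist S nu; exists b.
have [b Hb] := choice H.
exists (\big[Num.min/1]_(nu : tangent x) b nu).
  by apply: lt_bigmin => // nu _; case: (Hb nu).
move=> nu f /admissible_compatible cf.
have [_ /(_ f cf)[out [inc [Hr Hl Hd]]]] := Hb nu.
have le : \big[Num.min/1]_(nu : tangent x) b nu <= b nu by apply: bigmin_le_cond.
by exists out, inc; split=> t tP; [apply: Hr|apply: Hl|apply: Hd]; lra.
Qed.

Section AtPoint.
Variables (x : gpoint X) (b0 : R).
Hypothesis b0_gt0 : 0 < b0.
Hypothesis slopes_b0 : forall (nu : tangent x) f, M f ->
  exists out inc, ray_slopes S nu f b0 out inc.
Implicit Types (a : {ffun tangent x -> 'I_r.+1}).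

(** No function of M growing at the rates a has exactly the rate a i at x in the
    direction i, because a jump above a is above the end of the step.  If the
    rates of functions of Q dropped to a i arbitrarily close to x, then the
    infimum of the functions of M that vanish at x and grow at the rates a
    would be such a function. *)
Lemma uniform_growth (Q : set (gpoint X -> R)) a i e :
  (a i < r)%N -> rank S (up a i) = rank S a -> 0 < e < b0 ->
  (forall f, M f -> Q f -> forall nu, growth f nu (slope_at S nu (a nu))%:~R e) ->
  exists2 e', 0 < e' <= e &
    forall f, M f -> Q f -> growth f i (slope_at S i (up a i i))%:~R e'.
Proof.
move=> ai rai e0 Gr; apply: contrapT => nex.
have R' := rank_at_rank_function x.
pose s : R := (slope_at S i (a i))%:~R.
(* The competing functions exceed the rate s only before eta, by at most K. *)
pose K : R := (slope_at S i ord_max)%:~R - s.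
have K0 : 0 <= K by rewrite subr_ge0 ler_int slope_at_le leq_ord.
pose A := [set h | [/\ M h, h x = 0 &
  forall nu, growth h nu (slope_at S nu (a nu))%:~R e]].
have almost eta : 0 < eta <= e -> exists2 h, A h &
    forall t, eta <= t <= e -> h (along i t) <= s * t + K * eta.
  move=> etaP; have [f [Mf [Qf nG]]] : exists f, M f /\ Q f /\
      ~ growth f i (slope_at S i (up a i i))%:~R eta.
    apply: contrapT => H; apply: nex; exists eta => // f Mf Qf.
    by apply: contrapT => nG; apply: H; exists f.
  have [out [inc H]] := slopes_b0 i Mf.
  have inc_eta : (inc eta <= a i)%N.
    rewrite leqNgt; apply/negP => lt; apply: nG.
    by apply: (ray_growth H); [lra|rewrite upE // eqxx addn1].
  exists (fun y => f y - f x).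
    split; [|by rewrite subrr|].
    - by case: admM => -[_ _ Mc] _ _ _ _; apply: (Mc _ (- f x)).
    - by move=> nu t t' t0 tt te; have := Gr f Mf Qf nu t t' t0 tt te; lra.
  move=> t tP; have C := ray_concave H (ltac:(lra) : e < b0).
  have [eta0 eta_e eta_t t_e] : [/\ 0 <= eta, eta <= e, eta <= t & t <= e].
    by split; lra.
  have C0 := concave_sub (lexx 0) eta_e C.
  have C1 := concave_sub eta0 (lexx e) C.
  have out_eta : (out eta <= a i)%N.
    apply: leq_trans inc_eta; case: H => _ _ /(_ eta) [] //; lra.
  have le_max : (slope_at S i (out 0))%:~R <= (slope_at S i ord_max)%:~R :> R.
    by rewrite ler_int slope_at_le leq_ord.
  have le_s : (slope_at S i (out eta))%:~R <= s by rewrite ler_int slope_at_le.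
  have := concave_le C0 (lexx 0) eta0 (lexx eta) le_max.
  have := concave_le C1 (lexx eta) eta_t t_e le_s.
  by rewrite along0 /K; lra.
have A0 : A !=set0 by have [|h Ah _] := almost e; [lra|exists h].
have Ac : A `<=` compatible S by move=> h [Mh _ _]; apply: admissible_compatible.
have Am f g : A f -> A g -> A (fun y => Order.min (f y) (g y)).
  move=> [Mf fx Gf] [Mg gx Gg]; split.
  - by case: admM => -[_ Mm _] _ _ _ _; apply: Mm.
  - by rewrite fx gx minxx.
  - move=> nu t t' t0 tt te; rewrite lerBrDr le_min.
    have := Gf nu t t' t0 tt te; have := Gg nu t t' t0 tt te.
    have : Num.min (f (along nu t')) (g (along nu t')) <= f (along nu t').
      by rewrite ge_min lexx.
    have : Num.min (f (along nu t')) (g (along nu t')) <= g (along nu t').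
      by rewrite ge_min lexx orbT.
    by lra.
have An f : A f -> f x = 0 by case.
pose g y := inf [set f y | f in A].
have Mg : M g.
  case: admM => _ _ clM _ _; apply: (inf_values_closed A0 Ac Am An clM).
  by move=> h [].
have g_le h y (Ah : A h) : g y <= h y := inf_values_le Ac An y Ah.
have le_g c y : (forall h, A h -> c <= h y) -> c <= g y := le_inf_values A0 (c := c) (x := y).
have gx0 : 0 <= g x by apply: le_g => h /An ->.
have cg := admissible_compatible Mg.
have Rg : RatG g by case: cg.
have [b [jb _ sb]] := compatible_jump x cg.
have Gg nu : growth g nu (slope_at S nu (a nu))%:~R e.
  move=> t t' t0 tt te; rewrite lerBrDr; apply: le_g => h Ah.
  have [_ _ /(_ nu t t' t0 tt te)] := Ah; have := g_le h (along nu t') Ah; lra.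
have ab nu : (a nu <= b nu)%N.
  rewrite -(slope_at_le S nu) -(ler_int R) -sb.
  by apply: growth_slope (Gg nu) => //; lra.
have abi := jump_above_level R' jb ab ai rai.
have slope_gt : s + 1 <= (slope g i)%:~R.
  by rewrite sb /s -(intrD R _ 1) ler_int lezD1 slope_at_incr.
have [d /andP[d0 de] Hd] := right_slope_minr (d' := e) (ltac:(lra)) (slopeP i Rg).
(* Small enough for the error K * eta to be less than d. *)
pose eta := d / (K + 2).
have eta0 : 0 < eta by rewrite divr_gt0 //; lra.
have etaE : eta * (K + 2) = d by rewrite /eta divfK // gt_eqF //; lra.
have Keta : 0 <= K * eta by rewrite mulr_ge0 // ltW.
have [|h Ah Hh] := almost eta; first by lra.
have := Hd d; rewrite add0r along0 => /(_ (ltac:(lra))) gd.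
have := Hh d (ltac:(lra)); have := g_le h (along i d) Ah.
have : d <= ((slope g i)%:~R - s) * d.
  by apply: ler_peMl; [apply: ltW|rewrite lerBrDl].
move: gd gx0 etaE eta0; clear; clearbody eta K; clearbody s.
by move: (slope g i)%:~R => m; lra.
Qed.

(** Chips placed close to x, one for each step of a path from the origin to a
    along which the rank drops, force the slopes at x to be at least a.  The
    steps where the rank does not drop come for free, by uniform_growth. *)
Lemma forced_growth a : 0 <= rank S a -> exists F (e : R),
  [/\ 0 < e < b0, (size F)%:Z = r%:Z - rank S a &
   forall f, M f -> (forall y, (count_mem y F)%:Z <= rank_of S f y) ->
     forall nu : tangent x, growth f nu (slope_at S nu (a nu))%:~R e].
Proof.
have b0P := b0_gt0; have R' := rank_at_rank_function x.
have [n] : exists n, (\sum_(nu : tangent x) a nu)%N = n by eexists.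
elim: n a => [|n IH] a an ra.
  have a0 nu : a nu = 0 :> nat.
    by move/eqP: an; rewrite sum_nat_eq0 => /forallP/(_ nu)/eqP.
  have [nu0 _] := tangent_inhabited x.
  exists [::], (b0 / 2); split; [lra|by rewrite (rank_origin R' nu0 a0) subrr|].
  move=> f Mf _ nu; have [out [inc H]] := slopes_b0 nu Mf.
  by apply: (ray_growth H); [lra|rewrite a0].
have [i ai] : exists i, (0 < a i)%N.
  apply: contrapT => nex; move: an; rewrite big1 // => nu _.
  by case: (posnP (a nu)) => // apos; case: nex; exists nu.
pose a' : {ffun tangent x -> 'I_r.+1} :=
  [ffun j => if j == i then inord (a i).-1 else a j].
have a'i : a' i = (a i).-1 :> nat.
  by rewrite ffunE eqxx inordK //; have := ltn_ord (a i); lia.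
have a'r : (a' i < r)%N by have := ltn_ord (a i); rewrite a'i; lia.
have aE : a = up a' i.
  apply/ffunP => j; apply: ord_inj; rewrite upE //.
  have [->|ji] := j =P i; first by rewrite a'i addn1 prednK.
  by rewrite ffunE (introF eqP ji) addn0.
have a'n : (\sum_(nu : tangent x) a' nu)%N = n.
  apply/eqP; rewrite -eqSS -an (bigD1 i) // [X in (_ == X)%N](bigD1 i) //=.
  rewrite -addSn a'i prednK // eqn_add2l; apply/eqP; apply: eq_bigr => j /negPf ji.
  by rewrite ffunE ji.
have up_ge := rank_up_ge R' a'r; have up_le := rank_up_le R' a'r.
rewrite -aE in up_ge up_le.
have [F [e [e0 sF HF]]] := IH a' a'n (le_trans ra up_le).
have [eqr|neqr] := eqVneq (rank S a) (rank S a').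
- have rup : rank S (up a' i) = rank S a' by rewrite -aE.
  have [e' e'0 Ge'] := uniform_growth (Q := [set f | forall y, (count_mem y F)%:Z
    <= rank_of S f y]) a'r rup e0 HF.
  exists F, e'; split; [lra|by rewrite eqr|] => f Mf Ff nu.
  have [->|nui] := eqVneq nu i; first by rewrite aE; apply: Ge'.
  have -> : a nu = a' nu by rewrite ffunE (negPf nui).
  by apply: growth_sub (HF f Mf Ff nu); lra.
- (* The chip at z makes the index before z larger than the index after z, which
     is at least a' i because z < e. *)
  pose z := e / 2; exists (along i z :: F), z; split; [rewrite /z; lra| |].
    move/eqP: neqr sF up_ge up_le; rewrite /=.
    by move: (rank S a) (rank S a') => u v; lia.
  move=> f Mf Ff.
  have Ff' y : (count_mem y F)%:Z <= rank_of S f y.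
    by apply: le_trans (Ff y); rewrite /= lez_nat leq_addl.
  have G := HF f Mf Ff'; move=> nu; have [->|nui] := eqVneq nu i; last first.
    have -> : a nu = a' nu by rewrite ffunE (negPf nui).
    by apply: growth_sub (G nu); rewrite /z; lra.
  have [out [inc H]] := slopes_b0 i Mf.
  have out_z : (a' i <= out z)%N.
    by apply: (growth_out H _ _ (G i)); rewrite /z; lra.
  have [oi ri] : (out z <= inc z)%N /\ rank_of S f (along i z) = (inc z)%:Z - (out z)%:Z.
    by case: H => _ _; apply; rewrite /z; lra.
  apply: (ray_growth H); first by rewrite /z; lra.
  have := Ff (along i z); rewrite ri /= eqxx aE upE // eqxx.
  by lia.
Qed.

(** The chips of forced_growth, together with chips at x up to degree r. *)
Lemma jump_realised a : jump (rank S (x := x)) a ->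
  exists2 f, M f & slopes_of f x = slope_vector S a.
Proof.
move=> ja; have R' := rank_at_rank_function x.
have ra : 0 <= rank S a by case: ja.
have [F [e [e0 sF HF]]] := forced_growth ra.
have [|f Mf Ff] := @admissible_points (F ++ nseq `|rank S a| x).
  apply/eqP; rewrite size_cat size_nseq -eqz_nat PoszD sF gez0_abs //.
  by rewrite subrK.
have cf := admissible_compatible Mf; exists f => //.
have [b [jb rb sb]] := compatible_jump x cf.
have ab nu : (a nu <= b nu)%N.
  rewrite -(slope_at_le S nu) -(ler_int R) -sb.
  apply: (@growth_slope _ _ _ _ e); [by case: cf|lra|apply: HF => // y].
  by apply: le_trans (Ff y); rewrite count_cat lez_nat leq_addr.
have := Ff x; rewrite count_cat count_nseq /= eqxx mul1n rb => rab.
have <- : b = a by apply: (jump_maximal R' ja ab); lia.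
by apply/ffunP => nu; rewrite !ffunE sb.
Qed.

(** The chips at x bound the slope from above, the chips on the ray bound it
    from below. *)
Lemma slope_realised (nu : tangent x) (i : 'I_r.+1) :
  exists2 f, M f & slope f nu = slope_at S nu i.
Proof.
have b0P := b0_gt0; have R' := rank_at_rank_function x; pose z := b0 / 2.
have [|f Mf Ff] := @admissible_points (nseq (r - i) x ++ nseq i (along nu z)).
  by rewrite size_cat !size_nseq subnK // -ltnS.
exists f => //; have cf := admissible_compatible Mf.
have [b [jb rb sb]] := compatible_jump x cf.
have [out [inc H]] := slopes_b0 nu Mf.
have [oi ri] : (out z <= inc z)%N /\ rank_of S f (along nu z) = (inc z)%:Z - (out z)%:Z.
  by case: H => _ _; apply; rewrite /z; lra.
have iz : (i <= inc z)%N.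
  have := Ff (along nu z); rewrite ri count_cat !count_nseq /= eqxx mul1n; lia.
have bi : (b nu <= i)%N.
  have := Ff x; rewrite rb count_cat !count_nseq /= eqxx mul1n.
  by have := rank_axis R' b nu; have := ltn_ord i; lia.
have ib : (i <= b nu)%N.
  rewrite -(slope_at_le S nu) -(ler_int R) -sb.
  apply: (@growth_slope _ _ _ _ z); [by case: cf|rewrite /z; lra|].
  by apply: (ray_growth H) => //; rewrite /z; lra.
by rewrite sb; congr slope_at; apply/ord_inj/eqP; rewrite eqn_leq bi.
Qed.

End AtPoint.

Lemma admissible_jump (x : gpoint X) a : jump (rank S (x := x)) a ->
  exists2 f, M f & slopes_of f x = slope_vector S a.
Proof. by have [b b0 Hb] := uniform_ray_slopes x; apply: jump_realised b0 Hb _. Qed.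

Lemma admissible_slope (x : gpoint X) (nu : tangent x) (i : 'I_r.+1) :
  exists2 f, M f & slope f nu = slope_at S nu i.
Proof. by have [b b0 Hb] := uniform_ray_slopes x; apply: slope_realised b0 Hb _ _. Qed.

Lemma slope_set_realised (x : gpoint X) (nu : tangent x) :
  slope_set S nu = [set slope f nu | f in M].
Proof.
apply/seteqP; split=> [_ [i _ <-]|_ [f Mf <-]].
  by have [f Mf <-] := admissible_slope nu i; exists f.
have [a [_ _ ->]] := compatible_jump x (admissible_compatible Mf).
by exists (a nu).
Qed.

End Admissible.

(** * Uniqueness of the slope structure *)

Lemma increasing_range_eq (r r' : nat) (f : 'I_r.+1 -> int) (g : 'I_r'.+1 -> int) :
  (forall i j : 'I_r.+1, (i < j)%N -> f i < f j) ->
  (forall i j : 'I_r'.+1, (i < j)%N -> g i < g j) ->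
  range f = range g ->
  [seq f i | i <- enum 'I_r.+1] = [seq g i | i <- enum 'I_r'.+1].
Proof.
have sorted_enum n (h : 'I_n -> int) : (forall i j : 'I_n, (i < j)%N -> h i < h j) ->
    sorted <%R [seq h i | i <- enum 'I_n].
  move=> h_incr; apply: (homo_sorted (e := fun i j : 'I_n => (i < j)%N) h_incr).
  by have := iota_ltn_sorted 0 n; rewrite -val_enum_ord sorted_map.
move=> f_incr g_incr fg; apply: (irr_sorted_eq lt_trans ltxx).
- exact: sorted_enum.
- exact: sorted_enum.
- move=> y; apply/mapP/mapP => -[i _ ->].
    have : range g (f i) by rewrite -fg; exists i.
    by move=> [j _ <-]; exists j; rewrite ?mem_enum.
  have : range f (g i) by rewrite fg; exists i.
  by move=> [j _ <-]; exists j; rewrite ?mem_enum.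
Qed.

Lemma admissible_slopes_eq (R : realType) (X : metric_graph R) (D : divisor X)
    (M : set (gpoint X -> R)) (r r' : nat)
    (S : slope_structure X r) (S' : slope_structure X r')
    (x : gpoint X) (nu : tangent x) :
  admissible D M S -> admissible D M S' ->
  [seq slope_at S nu i | i <- enum 'I_r.+1] =
  [seq slope_at S' nu i | i <- enum 'I_r'.+1].
Proof.
move=> admS admS'; apply: increasing_range_eq => [i j|i j|].
- by rewrite slope_at_incr.
- by rewrite slope_at_incr.
- by rewrite -[LHS]/(slope_set S nu) (slope_set_realised admS) -(slope_set_realised admS').
Qed.

(** A jump for S is the vector of slopes of some f in M, hence a jump for S'. *)
Lemma admissible_rank_le (R : realType) (X : metric_graph R) (D : divisor X)
    (M : set (gpoint X -> R)) (r : nat) (S S' : slope_structure X r) (x : gpoint X) a :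
  admissible D M S -> admissible D M S' -> rank S a <= rank S' (x := x) a.
Proof.
move=> admS admS'; have [nu0 _] := tangent_inhabited x.
apply: (rank_le_of_jumps nu0).
- exact: rank_at_rank_function.
- exact: rank_at_rank_function.
- move=> b /(admissible_jump admS)[f Mf fb].
  have [b' [jb' _ sb']] := compatible_jump x (admissible_compatible admS' Mf).
  suff -> : b = b' by [].
  apply/ffunP => nu; apply: (@slope_at_inj _ _ _ S x nu).
  have /ffunP/(_ nu) := fb; rewrite !ffunE => <-; rewrite sb'.
  have /eq_in_map H := admissible_slopes_eq nu admS admS'.
  by rewrite H ?mem_enum.
Qed.

Theorem corollary1p3 (R : realType) (X : metric_graph R) (D : divisor X)
    (M : set (gpoint X -> R)) (r r' : nat)
    (S : slope_structure X r) (S' : slope_structure X r') :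
  admissible D M S -> admissible D M S' -> eq_slope_structure S S'.
Proof.
move=> admS admS'.
have rr' : r = r'.
  have /card_gt0P[e _] := has_edge X.
  have [nu _] := tangent_inhabited (inl (src e) : gpoint X).
  have := congr1 size (admissible_slopes_eq nu admS admS').
  by rewrite size_map size_enum_ord size_map size_enum_ord => -[].
subst r'; split=> // [x nu|x a a' aa'].
  by rewrite (slope_set_realised admS) (slope_set_realised admS').
have -> : a' = a by apply/ffunP => nu; apply: ord_inj.
apply/le_anti; rewrite (admissible_rank_le a admS admS').
exact: admissible_rank_le a admS' admS.
Qed.
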